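(* Let $K$ be a commutative field of characteristic $\neq 2$. For all integers $p,q\ge2$, $r,s\ge0$ and letters $a,a_1,a_2\in\{y,z\}$ with $a_1\ne a_2$, put \begin{align*} E^{[n]}_{p,q}(x)&=x^px^q-x^{p+1}-x^{q+1}+x^2,\\ E^{[n,1]}_{p,q}(x,a)&=x^p(x^qa)-x(xa)-x^pa-x^{q+1}a+x^2a+xa,\\ E^{[n,1]}_{p,\{r\}}(x,a)&=x^p(x^{\{r\}}a)-x^pa-x^{\{r+1\}}a+xa,\\ E^{[n,1]}_{\{r\},p}(x,a)&=x^{\{r\}}(x^pa)-x^{\{r+1\}}a-x^{p+r}a+x^{r+1}a,\\ E^{[n,1,1]}_{p,q}(x,y,z)&=(x^py)(x^qz)+x^{\{p\}}(yz)+x^{\{q\}}(yz)-\sum_{i=0}^{p-1}x^{\{i\}}\bigl((xy)z+(xz)y-2yz\bigr)\\ &\quad-\sum_{i=1}^{q-1}x^{\{i\}}\bigl((xy)z+(xz)y-2yz\bigr)-4x(yz)-yz,\\ E^{[n,1,1]}_{\{r\},\{s\}}(x,y,z)&=(x^{\{r\}}y)(x^{\{s\}}z)-\sum_{i=0}^{r-1}x^{\{i\}}\bigl((xy)z-yz\bigr)-\sum_{i=0}^{s-1}x^{\{i\}}\bigl((xz)y-yz\bigr)-yz,\\ E^{[n,1,1]}_{p}(x,a_1,a_2)&=(x^pa_1)a_2-\sum_{i=1}^{p-1}x^{\{i\}}\bigl((xa_1)a_2+(xa_2)a_1-2a_1a_2\bigr)+x^{\{p\}}(a_1a_2)-(xa_1)a_2-x(a_1a_2),\\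 E^{[n,1,1]}_{p,\{r\}}(x,a_1,a_2)&=(x^pa_1)(x^{\{r+1\}}a_2)-\sum_{i=0}^{p-1}x^{\{i\}}\bigl((xa_1)a_2+(xa_2)a_1-2a_1a_2\bigr)\\ &\quad-\sum_{i=1}^{r}x^{\{i\}}\bigl((xa_2)a_1-a_1a_2\bigr)+x^{\{p\}}(a_1a_2)-x(a_1a_2)-a_1a_2,\\ F^{[n,1,1]}_{p,\{r\}}(x,y,z)&=x^p\bigl(x^{\{r\}}(yz)\bigr)-\sum_{i=0}^{p-2}x^{\{i\}}\bigl((xy)z+(xz)y-2yz\bigr)+x^{\{p-1\}}(yz)-x^{\{r+1\}}(yz)-yz,\\ G^{[n,1,1]}_{p,\{r\}}(x,a_1,a_2)&=x^p\bigl(x^{\{r\}}((xa_1)a_2)\bigr)-\sum_{i=0}^{p-2}x^{\{i\}}\bigl((xa_1)a_2+(xa_2)a_1-2a_1a_2\bigr)\\ &\quad-x^{\{r+1\}}\bigl((xa_1)a_2\bigr)+x^{\{p-1\}}(a_1a_2)-a_1a_2 . \end{align*} Let $\mathscr H$ be the ideal generated by the family of all these polynomials ($p,q\ge2$, $r,s\ge0$) and let $\pi:K(x,y,z)\to K(x,y,z)/\mathscr H$ be the canonical surjection. Let $\mathscr F=\{x^{\{r\}}((xy)z),\ x^{\{r\}}((xz)y),\ x^{\{r\}}(yz) : r\ge0\}$. Then for every $n\ge2$ and every monomial $w\in\mathfrak M(x,y,z)_{[n,1,1]}$ such that $w\notin\mathscr F$ one has $\pi(w)=P_w$, and for every $f\in\bigoplus_{n\ge2}K(x,y,z)_{[n,1,1]}$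 the polynomial $f-\pi(f)$ is an evanescent train identity. Here, for such $w$, $P_w$ denotes the unique polynomial of $\mathbb Q\langle\mathscr F\rangle$ with $|P_w|_x\le n$ such that $w-P_w$ is an evanescent train identity.
   Context: $\mathfrak M(x,y,z)$ is the set of commutative nonassociative monomials in the letters $x,y,z$ (free commutative magma); $K(x,y,z)$ is the free commutative nonassociative $K$-algebra with basis $\mathfrak M(x,y,z)$. A monomial has type $[k,l,m]$ if $x,y,z$ occur respectively $k,l,m$ times; $\mathfrak M(x,y,z)_{[k,l,m]}$ is the set of monomials of that type and $K(x,y,z)_{[k,l,m]}$ its span; a polynomial is homogeneous if all its monomials have the same type; for a letter $b$, $|f|_b$ is the maximal number of occurrences of $b$ in the monomials of $f$. $K$ is assumed to satisfy $\operatorname{card}K^*>\max(|f|_x,|f|_y,|f|_z)$ for the polynomials $f$ considered. Principal powers: $x^1=x$, $x^{k+1}=x\,x^k$. For a polynomial $g$: $x^{\{0\}}g=g$, $x^{\{r\}}g=x\,(x^{\{r-1\}}g)$. Empty sums are $0$. $\mathbb Q\langle\mathscr F\rangle$ is the $\mathbb Q$-vector space spanned by $\mathscr F$. In the expressions $\pi(w)=P_w$ and $f-\pi(f)$, the class $\pi(f)$ is written as a linear combination of elements of $\mathscr F$, obtained by reducing $f$ modulo the generators of $\mathscr H$. For a letter $b$, $\partial_b:K(x,y,z)\to K[t]$ is the linear map with $\partial_b(b)=1$, $\partial_b(c)=0$ for a letter $c\ne b$, and $\partial_b(uv)=t(\partial_bu+\partial_bv)$ for monomials $u,v$. A polynomial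 $f$ is an evanescent identity if $f\ne0$, $\partial_xf=\partial_yf=\partial_zf=0$ and $f(1,1,1)=0$, where $f(1,1,1)$ is the sum of the coefficients of $f$. A train polynomial of degree $(n,1,1)$ is a non-homogeneous polynomial $f=g-\sum_{i=1}^rh_i$ with $f(1,1,1)=0$, $g$ homogeneous of type $[n,1,1]$, and each $h_i$ homogeneous of type $[\delta_i,1,1]$, where $0\le\delta_1<\dots<\delta_r<n$. An evanescent train identity is a train polynomial that is an evanescent identity.
   Formalization: In E^{[n,1,1]}_{p,q} the term -4x(yz) is corrected to -2x(yz) (with -4 the coefficients sum to -2); f-π(f) is claimed an evanescent identity only if nonzero, and an evanescent train identity only if non-homogeneous (f=0 fails the literal claim). *)

(* Defs.v *)
From HB Require Import structures.
From mathcomp Require Import all_boot all_order all_algebra.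
From mathcomp Require Import finmap.
From mathcomp.multinomials Require Import monalg.

Set Implicit Arguments.
Unset Strict Implicit.
Unset Printing Implicit Defensive.

Import GRing.Theory.

Local Open Scope ring_scope.

Inductive letter := Lx | Ly | Lz.

Definition ord_of_letter (b : letter) : 'I_3 :=
  match b with Lx => inord 0 | Ly => inord 1 | Lz => inord 2 end.

Definition letter_of_ord (i : 'I_3) : letter :=
  match val i with 0 => Lx | 1 => Ly | _ => Lz end%N.

Lemma ord_of_letterK : cancel ord_of_letter letter_of_ord.
Proof. by case; rewrite /letter_of_ord /= inordK. Qed.

HB.instance Definition _ := Countable.copy letter (can_type ord_of_letterK).

Inductive tree := Leaf of letter | Node of tree & tree.

Fixpoint tree_encode (t : tree) : GenTree.tree letter :=
  match t with
  | Leaf b => GenTree.Leaf b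
  | Node u v => GenTree.Node 0 [:: tree_encode u; tree_encode v]
  end.

Fixpoint tree_decode (t : GenTree.tree letter) : option tree :=
  match t with
  | GenTree.Leaf b => Some (Leaf b)
  | GenTree.Node _ [:: u; v] =>
      if (tree_decode u, tree_decode v) is (Some u', Some v')
      then Some (Node u' v') else None
  | _ => None
  end.

Lemma tree_encodeK : pcancel tree_encode tree_decode.
Proof. by elim=> //= u -> v ->. Qed.

HB.instance Definition _ := Countable.copy tree (pcan_type tree_encodeK).

(* Equality of binary trees up to exchanging the two sons of any nodes. *)
Fixpoint teq (t u : tree) : bool :=
  match t, u with
  | Leaf a, Leaf b => a == b
  | Node t1 t2, Node u1 u2 =>
      (teq t1 u1 && teq t2 u2) || (teq t1 u2 && teq t2 u1)
  | _, _ => false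
  end.

Lemma teq_refl : reflexive teq.
Proof. by elim=> [b|u IHu v IHv] /=; rewrite ?eqxx ?IHu ?IHv. Qed.

Lemma teq_sym : symmetric teq.
Proof.
elim=> [a|t1 IH1 t2 IH2] [b|u1 u2] //=.
by rewrite !IH1 !IH2 [teq u2 t1 && _]andbC.
Qed.

Lemma teq_trans : transitive teq.
Proof.
move=> u t; elim: t u => [a|t1 IH1 t2 IH2] [b|u1 u2] [c|v1 v2] //=.
  by move=> /eqP-> /eqP->.
by case/orP=> /andP[h1 h2] /orP[] /andP[k1 k2]; apply/orP;
  [left | right | right | left]; apply/andP; split;
  first [exact: IH1 h1 k1 | exact: IH1 h1 k2
       | exact: IH2 h2 k1 | exact: IH2 h2 k2].
Qed.

Canonical teq_equiv := EquivRel teq teq_refl teq_sym teq_trans.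

(* The free commutative magma on x, y, z. *)
Definition cmon := {eq_quot teq}%qT.

HB.instance Definition _ := Choice.on cmon.
HB.instance Definition _ := EqQuotient.on cmon.

Definition cletter (b : letter) : cmon := \pi_cmon%qT (Leaf b).

Definition cmul (u v : cmon) : cmon := \pi_cmon%qT (Node (repr u) (repr v)).

(* Functions on cmon are defined on a representative; cocc_cmul and       *)
(* dmon_cmul below give the recursive description on products.            *)
Fixpoint tocc (b : letter) (t : tree) : nat :=
  match t with
  | Leaf c => b == c
  | Node u v => tocc b u + tocc b v
  end.

Definition cocc (b : letter) (w : cmon) : nat := tocc b (repr w).

Definition mtype (w : cmon) : nat * nat * nat :=
  (cocc Lx w, cocc Ly w, cocc Lz w).

(* x^{r} w *)
Definition cxiter (r : nat) (w : cmon) : cmon := iter r (cmul (cletter Lx)) w.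

Definition calF (w : cmon) : Prop :=
  exists r : nat,
    [\/ w = cxiter r (cmul (cmul (cletter Lx) (cletter Ly)) (cletter Lz)),
        w = cxiter r (cmul (cmul (cletter Lx) (cletter Lz)) (cletter Ly))
      | w = cxiter r (cmul (cletter Ly) (cletter Lz))].

Section Algebra.

Variable K : fieldType.

(* K(x,y,z) is the K-module {malg K[cmon]} of finitely supported          *)
(* functions cmon -> K, with the bilinear product extending cmul.         *)
Definition pmul (f g : {malg K[cmon]}) : {malg K[cmon]} :=
  \sum_(u <- msupp f) \sum_(v <- msupp g) << f@_u * g@_v *g cmul u v >>.

Local Notation "f ** g" := (pmul f g) (at level 40, left associativity).

Fixpoint tpartial (b : letter) (t : tree) : {poly K} :=
  match t with
  | Leaf c => (b == c)%:R
  | Node u v => 'X * (tpartial b u + tpartial b v)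
  end.

Definition dmon (b : letter) (w : cmon) : {poly K} := tpartial b (repr w).

Definition partial (b : letter) (f : {malg K[cmon]}) : {poly K} :=
  \sum_(w <- msupp f) f@_w *: dmon b w.

(* f(1,1,1) *)
Definition sumcoef (f : {malg K[cmon]}) : K := \sum_(w <- msupp f) f@_w.

(* |f|_b *)
Definition degl (b : letter) (f : {malg K[cmon]}) : nat :=
  \max_(w <- msupp f) cocc b w.

Definition has_type (f : {malg K[cmon]}) (kappa : nat * nat * nat) : Prop :=
  f != 0 /\ forall w, w \in msupp f -> mtype w = kappa.

(* The zero polynomial counts as homogeneous, but has no type. *)
Definition homogeneous (f : {malg K[cmon]}) : Prop :=
  forall u v, u \in msupp f -> v \in msupp f -> mtype u = mtype v.

Definition evanescent_identity (f : {malg K[cmon]}) : Prop :=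
  [/\ f != 0, forall b, partial b f = 0 & sumcoef f = 0].

Definition train_polynomial (n : nat) (f : {malg K[cmon]}) : Prop :=
  [/\ ~ homogeneous f, sumcoef f = 0
    & exists (g : {malg K[cmon]}) (r : nat)
             (delta : 'I_r -> nat) (h : 'I_r -> {malg K[cmon]}),
      [/\ f = g - \sum_(i < r) h i,
          has_type g (n, 1, 1)%N,
          forall i, has_type (h i) (delta i, 1, 1)%N,
          forall i j : 'I_r, (i < j)%N -> (delta i < delta j)%N
        & forall i, (delta i < n)%N]].

Definition evanescent_train_identity (f : {malg K[cmon]}) : Prop :=
  evanescent_identity f /\ exists n, train_polynomial n f.

(* The K-span of calF. *)
Definition in_spanF (f : {malg K[cmon]}) : Prop :=
  forall w, w \in msupp f -> calF w.

(* The direct sum over n >= 2 of the K(x,y,z)_[n,1,1]. *)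
Definition in_sum_n11 (f : {malg K[cmon]}) : Prop :=
  forall w, w \in msupp f -> exists2 n, (2 <= n)%N & mtype w = (n, 1, 1)%N.

(* card K^* > max (|f|_x, |f|_y, |f|_z), for K finite or infinite. *)
Definition enough_scalars (f : {malg K[cmon]}) : Prop :=
  exists s : seq K,
    [/\ uniq s, 0 \notin s
      & (maxn (degl Lx f) (maxn (degl Ly f) (degl Lz f)) < size s)%N].

Local Notation X := (<< cletter Lx >> : {malg K[cmon]}).
Local Notation Y := (<< cletter Ly >> : {malg K[cmon]}).
Local Notation Z := (<< cletter Lz >> : {malg K[cmon]}).
Local Notation L a := (<< cletter a >> : {malg K[cmon]}).

(* Principal power x^k, for k >= 1 (k = 0 also yields x, and is not used). *)
Definition xpow (k : nat) : {malg K[cmon]} := iter k.-1 (pmul X) X.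

(* x^{r} g *)
Definition xit (r : nat) (g : {malg K[cmon]}) : {malg K[cmon]} :=
  iter r (pmul X) g.

Definition E_n (p q : nat) : {malg K[cmon]} :=
  xpow p ** xpow q - xpow p.+1 - xpow q.+1 + xpow 2.

Definition E_n1 (p q : nat) (a : letter) : {malg K[cmon]} :=
  xpow p ** (xpow q ** L a) - X ** (X ** L a) - xpow p ** L a
  - xpow q.+1 ** L a + xpow 2 ** L a + X ** L a.

Definition E_n1_pow_iter (p r : nat) (a : letter) : {malg K[cmon]} :=
  xpow p ** xit r (L a) - xpow p ** L a - xit r.+1 (L a) + X ** L a.

Definition E_n1_iter_pow (r p : nat) (a : letter) : {malg K[cmon]} :=
  xit r (xpow p ** L a) - xit r.+1 (L a) - xpow (p + r) ** L a
  + xpow r.+1 ** L a.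

(* (x a1) a2 + (x a2) a1 - 2 a1 a2 *)
Definition S12 (a1 a2 : letter) : {malg K[cmon]} :=
  (X ** L a1) ** L a2 + (X ** L a2) ** L a1 - (L a1 ** L a2) *+ 2.

(* The coefficient of x(yz) has to be -2: it is forced by f(1,1,1) = 0    *)
(* and by the vanishing of the partials (the value -4 gives               *)
(* f(1,1,1) = -2).                                                        *)
Definition E_n11 (p q : nat) : {malg K[cmon]} :=
  (xpow p ** Y) ** (xpow q ** Z) + xit p (Y ** Z) + xit q (Y ** Z)
  - \sum_(0 <= i < p) xit i (S12 Ly Lz)
  - \sum_(1 <= i < q) xit i (S12 Ly Lz)
  - (X ** (Y ** Z)) *+ 2 - Y ** Z.

Definition E_n11_iter_iter (r s : nat) : {malg K[cmon]} :=
  xit r Y ** xit s Z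
  - \sum_(0 <= i < r) xit i ((X ** Y) ** Z - Y ** Z)
  - \sum_(0 <= i < s) xit i ((X ** Z) ** Y - Y ** Z) - Y ** Z.

Definition E_n11_pow (p : nat) (a1 a2 : letter) : {malg K[cmon]} :=
  (xpow p ** L a1) ** L a2 - \sum_(1 <= i < p) xit i (S12 a1 a2)
  + xit p (L a1 ** L a2) - (X ** L a1) ** L a2 - X ** (L a1 ** L a2).

Definition E_n11_pow_iter (p r : nat) (a1 a2 : letter) : {malg K[cmon]} :=
  (xpow p ** L a1) ** xit r.+1 (L a2)
  - \sum_(0 <= i < p) xit i (S12 a1 a2)
  - \sum_(1 <= i < r.+1) xit i ((X ** L a2) ** L a1 - L a1 ** L a2)
  + xit p (L a1 ** L a2) - X ** (L a1 ** L a2) - L a1 ** L a2.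

Definition F_n11 (p r : nat) : {malg K[cmon]} :=
  xpow p ** xit r (Y ** Z) - \sum_(0 <= i < p.-1) xit i (S12 Ly Lz)
  + xit p.-1 (Y ** Z) - xit r.+1 (Y ** Z) - Y ** Z.

Definition G_n11 (p r : nat) (a1 a2 : letter) : {malg K[cmon]} :=
  xpow p ** xit r ((X ** L a1) ** L a2)
  - \sum_(0 <= i < p.-1) xit i (S12 a1 a2)
  - xit r.+1 ((X ** L a1) ** L a2) + xit p.-1 (L a1 ** L a2) - L a1 ** L a2.

Inductive genH : {malg K[cmon]} -> Prop :=
| genH_E_n p q of (2 <= p)%N & (2 <= q)%N : genH (E_n p q)
| genH_E_n1 p q a of (2 <= p)%N & (2 <= q)%N & a \in [:: Ly; Lz] :
    genH (E_n1 p q a)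
| genH_E_n1_pow_iter p r a of (2 <= p)%N & a \in [:: Ly; Lz] :
    genH (E_n1_pow_iter p r a)
| genH_E_n1_iter_pow r p a of (2 <= p)%N & a \in [:: Ly; Lz] :
    genH (E_n1_iter_pow r p a)
| genH_E_n11 p q of (2 <= p)%N & (2 <= q)%N : genH (E_n11 p q)
| genH_E_n11_iter_iter r s : genH (E_n11_iter_iter r s)
| genH_E_n11_pow p a1 a2 of (2 <= p)%N & a1 \in [:: Ly; Lz]
    & a2 \in [:: Ly; Lz] & a1 != a2 : genH (E_n11_pow p a1 a2)
| genH_E_n11_pow_iter p r a1 a2 of (2 <= p)%N & a1 \in [:: Ly; Lz]
    & a2 \in [:: Ly; Lz] & a1 != a2 : genH (E_n11_pow_iter p r a1 a2)
| genH_F_n11 p r of (2 <= p)%N : genH (F_n11 p r)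
| genH_G_n11 p r a1 a2 of (2 <= p)%N & a1 \in [:: Ly; Lz]
    & a2 \in [:: Ly; Lz] & a1 != a2 : genH (G_n11 p r a1 a2).

Inductive ideal_gen (S : {malg K[cmon]} -> Prop) : {malg K[cmon]} -> Prop :=
| ideal_gen_in f of S f : ideal_gen S f
| ideal_gen0 : ideal_gen S 0
| ideal_genD f g of ideal_gen S f & ideal_gen S g : ideal_gen S (f + g)
| ideal_genZ c f of ideal_gen S f : ideal_gen S (c *: f)
| ideal_genMl g f of ideal_gen S f : ideal_gen S (g ** f)
| ideal_genMr g f of ideal_gen S f : ideal_gen S (f ** g).

Definition calH : {malg K[cmon]} -> Prop := ideal_gen genH.

(* pi f = pi g in the quotient K(x,y,z) / calH. *)
Definition eq_mod_calH (f g : {malg K[cmon]}) : Prop := calH (f - g).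

(* P has the properties that characterize P_w, for w of type [n,1,1]. *)
Definition is_P (n : nat) (w : cmon) (P : {malg K[cmon]}) : Prop :=
  [/\ in_spanF P, (degl Lx P <= n)%N & evanescent_train_identity (<< w >> - P)].

(* R is a linear combination of elements of calF that represents pi f. *)
Definition is_reduction (f R : {malg K[cmon]}) : Prop :=
  in_spanF R /\ eq_mod_calH f R.

(* Extension of scalars; ratr is the intended map Q -> K on rationals     *)
(* whose denominator is nonzero in K.                                     *)
Definition defined_over (P : {malg rat[cmon]}) : Prop :=
  forall w, (denq P@_w)%:~R != 0 :> K.

Definition scalar_ext (P : {malg rat[cmon]}) : {malg K[cmon]} :=
  \sum_(w <- msupp P) << ratr P@_w *g w >>.

End Algebra.

Lemma cmulC : commutative cmul.
Proof.
move=> u v; apply/eqP; rewrite /cmul eqmodE /=.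
by rewrite !teq_refl orbT.
Qed.

Lemma teq_tocc b t u : teq t u -> tocc b t = tocc b u.
Proof.
elim: t u => [a|t1 IH1 t2 IH2] [c|u1 u2] //= => [/eqP-> //|].
by case/orP=> /andP[/IH1-> /IH2->] //; rewrite addnC.
Qed.

Lemma teq_tpartial (K : fieldType) b t u :
  teq t u -> tpartial K b t = tpartial K b u.
Proof.
elim: t u => [a|t1 IH1 t2 IH2] [c|u1 u2] //= => [/eqP-> //|].
by case/orP=> /andP[/IH1-> /IH2->] //; rewrite addrC.
Qed.

Lemma teq_repr_pi t : teq (repr (\pi_cmon%qT t)) t.
Proof. by have /eqP := reprK (\pi_cmon%qT t); rewrite eqmodE. Qed.

Lemma cocc_cletter b c : cocc b (cletter c) = (b == c).
Proof. by rewrite /cocc (teq_tocc b (teq_repr_pi _)). Qed.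

Lemma cocc_cmul b u v : cocc b (cmul u v) = (cocc b u + cocc b v)%N.
Proof. by rewrite /cocc (teq_tocc b (teq_repr_pi _)). Qed.

Lemma dmon_cletter (K : fieldType) b c : dmon K b (cletter c) = (b == c)%:R.
Proof. by rewrite /dmon (teq_tpartial K b (teq_repr_pi _)). Qed.

Lemma dmon_cmul (K : fieldType) b u v :
  dmon K b (cmul u v) = 'X * (dmon K b u + dmon K b v).
Proof. by rewrite /dmon (teq_tpartial K b (teq_repr_pi _)). Qed.

Lemma pmulUU (K : fieldType) (u v : cmon) :
  pmul (<< u >> : {malg K[cmon]}) << v >> = << cmul u v >>.
Proof.
by rewrite /pmul !msuppU !oner_eq0 !big_seq_fset1 !mcoeffUU mulr1.
Qed.

(* Main.v *)
(* The partials at b record the depths of the leaves b.  Every generator of calH has zero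
   partials and coefficient sum, and both properties pass to the ideal; they are injective on
   the span of calF, because a combination with coefficient polynomials a, b, c (one for each
   of the three families of calF) and zero partials satisfies a = b, c = - (1 + t) a and
   (2 t - 1) (t - 1) a = 0.  This gives uniqueness.  For existence, the generators rewrite any
   product of two normal forms (principal powers x^k in type [n], x^k a and x^{r} a in type
   [n,1], elements of calF in type [n,1,1]) as an integral combination of normal forms.  If
   w - P_w were homogeneous, comparing the coefficients of t^n and t^(n+1) of the partials would
   give w a leaf at depth n + 1 (here 2 <> 0 is needed), so w would be a caterpillar in calF. *)

Require Import Defs.
From HB Require Import structures.
From mathcomp Require Import all_boot all_order all_algebra.
From mathcomp Require Import finmap.
From mathcomp.multinomials Require Import monalg.
From mathcomp Require Import ring zify.

Set Implicit Arguments.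
Unset Strict Implicit.
Unset Printing Implicit Defensive.

Import GRing.Theory.

Local Open Scope ring_scope.

Local Notation "f ** g" := (pmul f g) (at level 40, left associativity).

(** * Monomial induction and linear extension *)

Lemma cmon_ind (P : cmon -> Prop) :
  (forall b, P (cletter b)) -> (forall u v, P u -> P v -> P (cmul u v)) ->
  forall w, P w.
Proof.
move=> Pl Pm w; rewrite -[w]reprK; elim: (repr w) => [b|t Pt u Pu]; first exact: Pl.
suff -> : \pi_cmon%qT (Node t u) = cmul (\pi_cmon%qT t) (\pi_cmon%qT u) by exact: Pm.
apply/eqP; rewrite eqmodE /=; apply/orP; left.
by rewrite ![teq _ (repr _)]teq_sym !teq_repr_pi.
Qed.

Lemma letter_eqE :
  (((Lx == Ly) = false) * ((Lx == Lz) = false) * ((Ly == Lx) = false)) *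
  (((Ly == Lz) = false) * ((Lz == Lx) = false) * ((Lz == Ly) = false)).
Proof. by do !split; apply/eqP. Qed.

Section LinearExtension.
Variable K : fieldType.
Implicit Types f g : {malg K[cmon]}.

Lemma malgUZ c (w : cmon) : << c *g w >> = c *: << w >> :> {malg K[cmon]}.
Proof. by apply/malgP => u; rewrite mcoeffZ !mcoeffU mulrnAr mulr1. Qed.

Lemma malg_ind (P : {malg K[cmon]} -> Prop) :
  P 0 -> (forall w, P << w >>) -> (forall c f g, P f -> P g -> P (c *: f + g)) ->
  forall f, P f.
Proof.
move=> P0 PU PD f; rewrite [f]monalgE.
elim/big_ind: _ => [//|g h Pg Ph|w _]; first by rewrite -[g]scale1r; exact: PD.
by rewrite malgUZ -[_ *: _]addr0; exact: PD.
Qed.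

Section Lext.
Variables (V : lmodType K) (phi : cmon -> V).

(** [partial b] is convertible to [lext (dmon K b)] and [pmul] is a double [lext], so one linearity
    proof serves them all. *)
Definition lext f : V := \sum_(w <- msupp f) f@_w *: phi w.

Lemma lextEw (d : {fset cmon}) f :
  (msupp f `<=` d)%fset -> lext f = \sum_(w <- d) f@_w *: phi w.
Proof.
move=> le_fd; rewrite /lext (big_fset_incl _ le_fd) //= => w _ /mcoeff_outdom ->.
by rewrite scale0r.
Qed.

Lemma lext_is_linear : linear lext.
Proof.
move=> c f g; pose d := (msupp f `|` msupp g)%fset.
rewrite (@lextEw d f) ?fsubsetUl // (@lextEw d g) ?fsubsetUr //.
rewrite (@lextEw d (c *: f + g)); last first.
  by apply: fsubset_trans (msuppD_le _ _) _; apply: fsetSU; exact: msuppZ_le.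
rewrite scaler_sumr -big_split /=; apply: eq_bigr => w _.
by rewrite mcoeffD mcoeffZ scalerDl scalerA.
Qed.

Lemma lextU w : lext << w >> = phi w.
Proof. by rewrite /lext msuppU oner_eq0 big_seq_fset1 mcoeffUU scale1r. Qed.

End Lext.

HB.instance Definition _ (V : lmodType K) (phi : cmon -> V) :=
  GRing.isLinear.Build K {malg K[cmon]} V *:%R (lext phi) (@lext_is_linear V phi).

HB.instance Definition _ b :=
  GRing.isLinear.Build K {malg K[cmon]} {poly K} *:%R (@partial K b)
    (@lext_is_linear _ (dmon K b)).

Lemma sumcoefE f : sumcoef f = lext (fun=> 1 : K^o) f.
Proof. by apply: eq_bigr => w _; rewrite /GRing.scale /= mulr1. Qed.

Lemma sumcoef_is_linear : linear_for *%R (@sumcoef K).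
Proof. by move=> c f g; rewrite !sumcoefE linearP. Qed.

HB.instance Definition _ :=
  GRing.isLinear.Build K {malg K[cmon]} K *%R (@sumcoef K) sumcoef_is_linear.

Lemma partialU b w : partial b (<< w >> : {malg K[cmon]}) = dmon K b w.
Proof. exact: lextU. Qed.

Lemma sumcoefU w : sumcoef (<< w >> : {malg K[cmon]}) = 1.
Proof. by rewrite sumcoefE lextU. Qed.

Lemma pmulE f g :
  f ** g = lext (fun u => lext (fun v => << cmul u v >> : {malg K[cmon]}) g) f.
Proof.
apply: eq_bigr => u _; rewrite /lext scaler_sumr; apply: eq_bigr => v _.
by rewrite malgUZ scalerA.
Qed.

Lemma pmulC : commutative (@pmul K).
Proof.
move=> f g; rewrite /pmul exchange_big /=; apply: eq_bigr => u _; apply: eq_bigr => v _.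
by rewrite cmulC mulrC.
Qed.

Lemma pmul_is_linear f : linear (pmul f).
Proof.
by move=> c g h; rewrite ![f ** _]pmulC !pmulE linearP.
Qed.

HB.instance Definition _ f :=
  GRing.isLinear.Build K {malg K[cmon]} {malg K[cmon]} *:%R (pmul f) (pmul_is_linear f).

Lemma xit_is_linear r : linear (@xit K r).
Proof. by elim: r => [|r IHr] c f g //=; rewrite IHr linearP. Qed.

HB.instance Definition _ r :=
  GRing.isLinear.Build K {malg K[cmon]} {malg K[cmon]} *:%R (@xit K r) (xit_is_linear r).

Lemma sumcoefM f g : sumcoef (f ** g) = sumcoef f * sumcoef g.
Proof.
elim/malg_ind: f => [|u|c f1 f2 IH1 IH2].
- by rewrite pmulC !linear0 mul0r.
- elim/malg_ind: g => [|v|c g1 g2 IH1 IH2].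
  + by rewrite !linear0 mulr0.
  + by rewrite pmulUU !sumcoefU mulr1.
  + by rewrite !linearP /= IH1 IH2; ring.
- by rewrite pmulC !linearP /= ![g ** _]pmulC IH1 IH2; ring.
Qed.

(** On monomials both coefficient sums are 1 and this is the defining rule of the partial;
    bilinearity does the rest. *)
Lemma partialM b f g :
  partial b (f ** g) =
    'X * ((sumcoef g)%:P * partial b f + (sumcoef f)%:P * partial b g).
Proof.
elim/malg_ind: f => [|u|c f1 f2 IH1 IH2].
- by rewrite pmulC !linear0; ring.
- elim/malg_ind: g => [|v|c g1 g2 IH1 IH2].
  + by rewrite !linear0; ring.
  + by rewrite pmulUU !sumcoefU !partialU dmon_cmul; ring.
  + rewrite !linearP /= IH1 IH2 -!mul_polyC polyCD polyCM; ring.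
- rewrite pmulC !linearP /= ![g ** _]pmulC IH1 IH2 -!mul_polyC polyCD polyCM; ring.
Qed.

(** Kept as an atom: ['X * geo r] is the contribution of the r letters x that x^{r} adds at depths
    1, ..., r. *)
Definition geo n : {poly K} := \sum_(i < n) 'X^i.

Lemma geoS n : geo n.+1 = 1 + 'X * geo n.
Proof.
rewrite /geo big_ord_recl expr0 mulr_sumr; congr (_ + _).
by apply: eq_bigr => i _; rewrite -exprS.
Qed.

(** Eliminates the powers of ['X] in favour of [geo], which brings identities with symbolic
    exponents within reach of [ring]. *)
Lemma geoE n : 'X^n = 1 + ('X - 1) * geo n.
Proof. by rewrite -subrX1 addrC subrK. Qed.

Lemma geo_sum0 n : \sum_(0 <= i < n) 'X^i = geo n.
Proof. by rewrite big_mkord. Qed.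

Lemma geo_sum1 n : \sum_(1 <= i < n.+1) 'X^i = 'X * geo n.
Proof.
rewrite big_add1 big_mkord mulr_sumr; apply: eq_bigr => i _; exact: exprS.
Qed.

Lemma sumcoef_xit r f : sumcoef (xit r f) = sumcoef f.
Proof. by elim: r => //= r IHr; rewrite sumcoefM sumcoefU mul1r. Qed.

Lemma partial_xit b r f :
  partial b (xit r f) =
    'X^r * partial b f + (b == Lx)%:R * (sumcoef f)%:P * ('X * geo r).
Proof.
elim: r => [|r IHr] /=; first by rewrite /geo big_ord0; ring.
rewrite partialM IHr sumcoef_xit sumcoefU partialU dmon_cletter geoS polyC1 exprS.
by case: eqP => _ /=; ring.
Qed.

(** * Vanishing of the partials on calH *)

Lemma xpowE k : xpow K k.+1 = xit k << cletter Lx >>.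
Proof. by []. Qed.

(** The evanescent identities together with 0, so that they form an ideal. *)
Definition null f := sumcoef f = 0 /\ forall b, partial b f = 0.

(** The values [c] and [d] are parameters so that [get_partials] can synthesize them by following
    the syntax of [f]. *)
Definition has_partials f (c : K) (d : letter -> {poly K}) :=
  sumcoef f = c /\ forall b, partial b f = d b.

Section HasPartials.
Variables (f g : {malg K[cmon]}) (c c' : K) (d d' : letter -> {poly K}).
Hypotheses (Hf : has_partials f c d) (Hg : has_partials g c' d').

Lemma has_partialsD : has_partials (f + g) (c + c') (fun b => d b + d' b).
Proof. by case: Hf Hg => <- df [<- dg]; split=> [|b]; rewrite linearD /= ?df ?dg. Qed.

Lemma has_partialsN : has_partials (- f) (- c) (fun b => - d b).
Proof. by case: Hf => <- df; split=> [|b]; rewrite linearN /= ?df. Qed.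

Lemma has_partialsMn n : has_partials (f *+ n) (c *+ n) (fun b => d b *+ n).
Proof. by case: Hf => <- df; split=> [|b]; rewrite linearMn /= ?df. Qed.

Lemma has_partials_pmul :
  has_partials (f ** g) (c * c') (fun b => 'X * (c'%:P * d b + c%:P * d' b)).
Proof.
case: Hf Hg => sf df [sg dg].
by split=> [|b]; rewrite ?sumcoefM ?partialM sf sg ?df ?dg.
Qed.

Lemma has_partials_xit r :
  has_partials (xit r f) c
    (fun b => 'X^r * d b + (b == Lx)%:R * c%:P * ('X * geo r)).
Proof.
by case: Hf => sf df; split=> [|b]; rewrite ?sumcoef_xit ?partial_xit sf ?df.
Qed.

(** With coefficient sum 0 the added letters x contribute nothing, so the sum over i only multiplies
    the partials by a sum of powers of ['X]. *)
Lemma has_partials_sum_xit m n : c = 0 ->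
  has_partials (\sum_(m <= i < n) xit i f) 0 (fun b => (\sum_(m <= i < n) 'X^i) * d b).
Proof.
case: Hf => sf df c0; split=> [|b]; rewrite linear_sum /=.
  by rewrite big1 // => i _; rewrite sumcoef_xit sf.
rewrite mulr_suml; apply: eq_bigr => i _.
by rewrite partial_xit sf c0 df polyC0; ring.
Qed.

End HasPartials.

Lemma has_partials_letter a : has_partials << cletter a >> 1 (fun b => (b == a)%:R).
Proof. by split=> [|b]; rewrite ?sumcoefU ?partialU ?dmon_cletter. Qed.

Lemma has_partials_xpow k :
  has_partials (xpow K k.+1) 1 (fun b => (b == Lx)%:R * ('X^k + 'X * geo k)).
Proof.
have [s d] := has_partials_xit (has_partials_letter Lx) k.
by split=> [//|b]; rewrite xpowE d; ring.
Qed.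

Lemma geoD m n : geo (m + n) = geo m + 'X^m * geo n.
Proof.
elim: m => [|m IHm]; first by rewrite /geo big_ord0; ring.
by rewrite addSn !geoS IHm exprS; ring.
Qed.

Lemma geo0 : geo 0 = 0. Proof. exact: big_ord0. Qed.

Ltac get_partials :=
  lazymatch goal with
  | |- has_partials (pmul _ _) _ _ => eapply has_partials_pmul; get_partials
  | |- has_partials (GRing.natmul _ _) _ _ => eapply has_partialsMn; get_partials
  | |- has_partials (xit _ _) _ _ => eapply has_partials_xit; get_partials
  | |- has_partials (xpow _ _.+1) _ _ => eapply has_partials_xpow
  | |- has_partials (mkmalgU _ _) _ _ => eapply has_partials_letter
  | |- has_partials (S12 _ _ _) _ _ => unfold S12; get_partials
  | |- has_partials (bigop.body _ _ _) _ _ =>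
      eapply has_partials_sum_xit; [get_partials | by ring]
  | |- has_partials (GRing.opp _) _ _ => eapply has_partialsN; get_partials
  | |- has_partials (GRing.add _ _) _ _ => eapply has_partialsD; get_partials
  end.

Lemma has_partials_null f c d :
  has_partials f c d -> c = 0 -> (forall b, d b = 0) -> null f.
Proof. by case=> sf df c0 d0; split=> [|b]; rewrite ?sf ?df. Qed.

(** For each letter the claim is an identity in ['X] and the [geo] of the exponents: shifted
    exponents are expanded, [geoE] removes the remaining powers, and [ring] concludes. *)
Ltac null_tac :=
  eapply has_partials_null; [get_partials | by ring | case];
  rewrite ?geo_sum0 ?geo_sum1 ?(polyCM, polyCD, polyCN, polyC1)
    ?(geoD, geoS, geo0, exprD, exprS, expr0, eqxx, letter_eqE) /= ?geoE; ring.

Lemma null_genH f : genH f -> null f.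
Proof.
case=> {f}.
(* Exponents at least 2 are written [p.+2], so that every [xpow] has the successor exponent which
   [get_partials] expects. *)
- by case=> [//|[//|p]] [//|[//|q]] _ _; rewrite /E_n; null_tac.
- case=> [//|[//|p]] [//|[//|q]] a _ _.
  by rewrite !inE => /orP[] /eqP->; rewrite /E_n1; null_tac.
- case=> [//|[//|p]] r a _.
  by rewrite !inE => /orP[] /eqP->; rewrite /E_n1_pow_iter; null_tac.
- move=> r [//|[//|p]] a _.
  by rewrite !inE => /orP[] /eqP->; rewrite /E_n1_iter_pow !addSn; null_tac.
- by case=> [//|[//|p]] [//|[//|q]] _ _; rewrite /E_n11; null_tac.
- by move=> r s; rewrite /E_n11_iter_iter; null_tac.
- case=> [//|[//|p]] a1 a2 _.
  by rewrite !inE => /orP[] /eqP-> /orP[] /eqP->; rewrite ?eqxx // => _;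
    rewrite /E_n11_pow; null_tac.
- case=> [//|[//|p]] r a1 a2 _.
  by rewrite !inE => /orP[] /eqP-> /orP[] /eqP->; rewrite ?eqxx // => _;
    rewrite /E_n11_pow_iter; null_tac.
- case=> [//|[//|p]] r _; rewrite /F_n11 -!pred_Sn; null_tac.
- case=> [//|[//|p]] r a1 a2 _.
  by rewrite !inE => /orP[] /eqP-> /orP[] /eqP->; rewrite ?eqxx // => _;
    rewrite /G_n11 -!pred_Sn; null_tac.
Qed.

(** The coefficient sum has to vanish along with the partials: by [partialM] it is the weight of the
    partials of the other factor. *)
Lemma null_calH f : calH f -> null f.
Proof.
elim=> {f} [f /null_genH //||f g _ [sf df] _ [sg dg]|c f _ [sf df]|g f _ [sf df]|g f _ [sf df]].
- by split=> [|b]; rewrite linear0.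
- by split=> [|b]; rewrite linearD /= ?sf ?sg ?df ?dg addr0.
- by split=> [|b]; rewrite linearZ /= ?sf ?df ?mulr0 ?scaler0.
- by split=> [|b]; rewrite ?sumcoefM ?partialM sf ?df ?mulr0 ?polyC0; ring.
- by split=> [|b]; rewrite ?sumcoefM ?partialM sf ?df ?mulr0 ?polyC0; ring.
Qed.

End LinearExtension.

(** * Injectivity of the partials on the span of calF *)

Section SpanF.
Variable K : fieldType.
Implicit Types f g : {malg K[cmon]}.

Lemma xitU r w : xit r << w >> = << cxiter r w >> :> {malg K[cmon]}.
Proof. by elim: r => //= r ->; rewrite pmulUU. Qed.

(** The action of K[t] in which t multiplies by x; over K[t] the span of calF is generated by (xy)z,
    (xz)y and yz. *)
Definition xcomb (p : {poly K}) f : {malg K[cmon]} := \sum_(i < size p) p`_i *: xit i f.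

Lemma xcombEw n (p : {poly K}) f :
  (size p <= n)%N -> xcomb p f = \sum_(i < n) p`_i *: xit i f.
Proof.
move=> le_pn; rewrite /xcomb (big_ord_widen n (fun i => p`_i *: xit i f) le_pn).
rewrite big_mkcond; apply: eq_bigr => i _; case: ltnP => // le_pi.
by rewrite nth_default ?scale0r.
Qed.

Lemma xcombP c (p q : {poly K}) f : xcomb (c *: p + q) f = c *: xcomb p f + xcomb q f.
Proof.
pose n := maxn (size p) (size q).
rewrite (@xcombEw n p) ?leq_maxl // (@xcombEw n q) ?leq_maxr // (@xcombEw n (_ + _)).
  rewrite scaler_sumr -big_split; apply: eq_bigr => i _ /=.
  by rewrite coefD coefZ scalerDl scalerA.
by rewrite (leq_trans (size_polyD _ _)) // geq_max leq_maxr
  (leq_trans (size_scale_leq _ _)) // leq_maxl.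
Qed.

Lemma xcomb0 f : xcomb 0 f = 0.
Proof. by rewrite /xcomb size_poly0 big_ord0. Qed.

Lemma xcombXn r f : xcomb 'X^r f = xit r f.
Proof.
rewrite /xcomb size_polyXn big_ord_recr /= big1 ?add0r => [|i _].
  by rewrite coefXn eqxx scale1r.
by rewrite coefXn ltn_eqF ?scale0r.
Qed.

(* Multiplying by 'X - 1 turns the partial sums of the powers of 'X into polynomials. *)
Lemma partial_xcomb b p f : sumcoef f = 1 ->
  ('X - 1) * partial b (xcomb p f) =
    ('X - 1) * (p * partial b f) + (b == Lx)%:R * ('X * (p - (p.[1])%:P)).
Proof.
move=> f1; have pE : p = \sum_(i < size p) p`_i *: 'X^i by rewrite -poly_def coefK.
have p1E : (p.[1])%:P = \sum_(i < size p) (p`_i)%:P.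
  by rewrite horner_coef rmorph_sum; apply: eq_bigr => i _; rewrite expr1n mulr1.
rewrite p1E [X in 'X * (X - _)]pE [X in X * partial b f]pE.
rewrite -sumrB linear_sum /= mulr_suml !mulr_sumr -big_split /=.
apply: eq_bigr => i _; rewrite linearZ /= partial_xit f1 -!mul_polyC polyC1.
rewrite (geoE K i); ring.
Qed.

Lemma in_spanF_xcomb f : in_spanF f -> exists a b c : {poly K},
  f = xcomb a << cmul (cmul (cletter Lx) (cletter Ly)) (cletter Lz) >> +
      xcomb b << cmul (cmul (cletter Lx) (cletter Lz)) (cletter Ly) >> +
      xcomb c << cmul (cletter Ly) (cletter Lz) >>.
Proof.
move=> Ff; rewrite [f]monalgE big_seq; elim/big_ind: _ => [|g h|w /Ff].
- by exists 0, 0, 0; rewrite !xcomb0 !addr0.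
- move=> [a [b [c ->]]] [a' [b' [c' ->]]].
  exists (1 *: a + a'), (1 *: b + b'), (1 *: c + c').
  by rewrite !xcombP !scale1r addrACA [X in X + _]addrACA.
- rewrite malgUZ; move: (f@_w) => k [r [] ->].
  + by exists (k *: 'X^r + 0), 0, 0; rewrite xcombP !xcomb0 !addr0 xcombXn xitU.
  + by exists 0, (k *: 'X^r + 0), 0; rewrite xcombP !xcomb0 !addr0 add0r xcombXn xitU.
  + by exists 0, 0, (k *: 'X^r + 0); rewrite xcombP !xcomb0 !addr0 !add0r xcombXn xitU.
Qed.

Lemma in_spanF_partial0 f : in_spanF f -> (forall b, partial b f = 0) -> f = 0.
Proof.
move=> /in_spanF_xcomb[a [b [c ->]]] df.
have /= eqs d := congr1 (fun p => ('X - 1) * p) (df d).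
have := eqs Ly; have := eqs Lz; have := eqs Lx => {eqs df}.
rewrite !linearD /= !mulrDr mulr0 !partial_xcomb ?sumcoefU // !partialU.
rewrite !dmon_cmul !dmon_cletter !eqxx !letter_eqE /=.
have X0 : 'X != 0 :> {poly K} by rewrite polyX_eq0.
have X1 : 'X - 1 != 0 :> {poly K} by rewrite polyXsubC_eq0.
move=> ex ez ey.
have cancel (p : {poly K}) : ('X - 1) * ('X * p) = 0 -> p = 0.
  by move=> /eqP; rewrite !mulf_eq0 (negPf X0) (negPf X1) => /eqP.
(* The letter y has depth 2 in (xy)z and depth 1 in (xz)y and yz; z is symmetric. *)
have {}ey : a * 'X + b + c = 0 by apply: cancel; rewrite -ey; ring.
have {}ez : a + b * 'X + c = 0 by apply: cancel; rewrite -ez; ring.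
have ab : a = b.
  apply/eqP; rewrite -subr_eq0.
  have : ('X - 1) * (a - b) = 0 by rewrite -(subrr 0) -{1}ey -ez; ring.
  by move=> /eqP; rewrite mulf_eq0 (negPf X1).
have cE : c = - ((1 + 'X) * a).
  by apply/eqP; rewrite -addr_eq0 -ey -ab; apply/eqP; ring.
(* With this value the terms [p.[1]] of the three families cancel in the equation for x. *)
have c1 : (c.[1])%:P = - ((a.[1])%:P *+ 2).
  by rewrite cE hornerN hornerM !hornerE mulrDl mul1r polyCN polyCD; ring.
have a0 : a = 0.
  apply/eqP; have : 'X * ((2 * 'X ^+ 2 - 3 * 'X + 1) * a) = 0.
    by rewrite -ex -ab c1 cE; ring.
  (* The quadratic factor takes the value 1 at 0, hence is nonzero in every characteristic. *)
  move=> /eqP; rewrite !mulf_eq0 (negPf X0) /= => /orP[/eqP /(congr1 (horner^~ 0))|//].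
  by rewrite !hornerE /= => /eqP; rewrite !(mulr0, expr0n, subr0, add0r) oner_eq0.
by rewrite cE -ab a0 mulr0 oppr0 !xcomb0 !addr0.
Qed.

End SpanF.

(** * Homogeneity and train polynomials *)

Section Train.
Variable K : fieldType.
Implicit Types f g : {malg K[cmon]}.

Definition nleaves w := (cocc Lx w + cocc Ly w + cocc Lz w)%N.

Lemma nleaves_letter b : nleaves (cletter b) = 1%N.
Proof. by rewrite /nleaves !cocc_cletter; case: b; rewrite !eqxx !letter_eqE. Qed.

Lemma nleaves_cmul u v : nleaves (cmul u v) = (nleaves u + nleaves v)%N.
Proof. by rewrite /nleaves !cocc_cmul; lia. Qed.

Lemma nleaves_gt0 w : (0 < nleaves w)%N.
Proof.
elim/cmon_ind: w => [b|u v u0 v0]; first by rewrite nleaves_letter.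
by rewrite nleaves_cmul; lia.
Qed.

Lemma nleaves1 w : nleaves w = 1%N -> exists b, w = cletter b.
Proof.
elim/cmon_ind: w => [b|u v _ _]; first by exists b.
by rewrite nleaves_cmul; have := nleaves_gt0 u; have := nleaves_gt0 v; lia.
Qed.

Lemma nleaves2 w : nleaves w = 2%N -> exists a b, w = cmul (cletter a) (cletter b).
Proof.
elim/cmon_ind: w => [b|u v _ _]; first by rewrite nleaves_letter.
rewrite nleaves_cmul => uv2; have u0 := nleaves_gt0 u; have v0 := nleaves_gt0 v.
have [a ->] : exists a, u = cletter a by apply: nleaves1; lia.
have [b ->] : exists b, v = cletter b by apply: nleaves1; lia.
by exists a, b.
Qed.

Lemma size_XM (p q : {poly K}) :
  (size ('X * (p + q))%R <= (maxn (size p) (size q)).+1)%N.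
Proof.
rewrite (leq_trans (size_polyMleq _ _)) // size_polyX addSn ltnS.
exact: size_polyD.
Qed.

Lemma size_dmon b w : (size (dmon K b w) <= nleaves w)%N.
Proof.
elim/cmon_ind: w => [a|u v su sv].
  by rewrite dmon_cletter nleaves_letter -polyC_natr; exact: size_polyC_leq1.
rewrite dmon_cmul nleaves_cmul (leq_trans (size_XM _ _)) //.
by have := nleaves_gt0 u; have := nleaves_gt0 v; lia.
Qed.

(** Depths in a factor stay below its number of leaves; the other factor brings at least two leaves
    but the product only one level. *)
Lemma size_dmon_cmul b u v : (1 < nleaves u)%N -> (1 < nleaves v)%N ->
  (size (dmon K b (cmul u v)) < nleaves (cmul u v))%N.
Proof.
move=> u1 v1.
rewrite dmon_cmul nleaves_cmul (leq_ltn_trans (size_XM _ _)) //.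
by have := size_dmon b u; have := size_dmon b v; lia.
Qed.

Lemma dmon0 b w : cocc b w = 0%N -> dmon K b w = 0.
Proof.
elim/cmon_ind: w => [a|u v IHu IHv].
  by rewrite cocc_cletter dmon_cletter => ->.
by rewrite cocc_cmul dmon_cmul => /eqP; rewrite addn_eq0 => /andP[/eqP/IHu-> /eqP/IHv->];
  rewrite addr0 mulr0.
Qed.

(** The exponent is the depth of the only leaf [b]. *)
Lemma dmon1 b w : cocc b w = 1%N -> exists i, dmon K b w = 'X^i.
Proof.
elim/cmon_ind: w => [a|u v IHu IHv].
  by rewrite cocc_cletter dmon_cletter => ->; exists 0%N; rewrite expr0.
rewrite cocc_cmul dmon_cmul => uv1.
have [u0|[v0]] : cocc b u = 0%N \/ cocc b v = 0%N by lia.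
  by have [|i ->] := IHv; [lia|exists i.+1; rewrite (dmon0 u0) add0r exprS].
by have [|i ->] := IHu; [lia|exists i.+1; rewrite (dmon0 v0) addr0 exprS].
Qed.

Lemma calF_cmul w : calF w -> calF (cmul (cletter Lx) w).
Proof. by case=> r [] ->; exists r.+1; [apply: Or31|apply: Or32|apply: Or33]. Qed.

(* A tree with n + 2 leaves, one of them at depth n + 1, is a caterpillar. *)
Lemma deep_calF n w : mtype w = (n, 1, 1)%N ->
  (forall k, (k < n)%N -> (dmon K Ly w)`_k = 0 /\ (dmon K Lz w)`_k = 0) ->
  (exists b, (dmon K b w)`_n.+1 != 0) -> calF w.
Proof.
elim/cmon_ind: w n => [b|u v IHu IHv] n.
  by rewrite /mtype !cocc_cletter; case: b; rewrite ?eqxx !letter_eqE.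
(* Products with a single leaf [a]; stated for either factor, since [cmulC] brings the leaf to the
   left. *)
have step a w : w = u \/ w = v -> mtype (cmul (cletter a) w) = (n, 1, 1)%N ->
    (forall k, (k < n)%N -> (dmon K Ly (cmul (cletter a) w))`_k = 0 /\
       (dmon K Lz (cmul (cletter a) w))`_k = 0) ->
    (exists b, (dmon K b (cmul (cletter a) w))`_n.+1 != 0) ->
    calF (cmul (cletter a) w).
  move=> wuv; have {IHu IHv} IH : forall n, mtype w = (n, 1, 1)%N ->
      (forall k, (k < n)%N -> (dmon K Ly w)`_k = 0 /\ (dmon K Lz w)`_k = 0) ->
      (exists b, (dmon K b w)`_n.+1 != 0) -> calF w.
    by case: wuv => ->.
  rewrite /mtype !cocc_cmul !cocc_cletter; case: a; rewrite !eqxx !letter_eqE /= ?add0n ?add1n.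
  (* Removing a factor x lowers the number of x and the depths of the other leaves by 1 together;
     the removed leaf only affects a coefficient of lower degree. *)
  - case: n => [[]//|n] [xw yw zw] low [b]; rewrite dmon_cmul mulrC coefMX /=.
    rewrite dmon_cletter -polyC_natr coefD coefC /= add0r => top.
    apply: calF_cmul; apply: (IH n); first by rewrite /mtype xw yw zw.
      move=> k kn; have := low k.+1 kn; rewrite !dmon_cmul mulrC coefMX /=.
      by rewrite mulrC coefMX /= !dmon_cletter !letter_eqE !add0r.
    by exists b.
  (* Here y has depth 1, which [low] forbids for n at least 2; only yz and (xz)y remain. *)
  - case=> xw yw zw low _; have w0 : dmon K Ly w = 0 by apply: dmon0.
    have n1 : (n <= 1)%N.
      rewrite leqNgt; apply/negP => /low[]; rewrite dmon_cmul dmon_cletter w0 eqxx.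
      by rewrite addr0 mulr1 coefX eqxx => /eqP; rewrite oner_eq0.
    have [n0|{}n1] : n = 0%N \/ n = 1%N by lia.
      have [|b wb] := @nleaves1 w; first by rewrite /nleaves; lia.
      move: zw; rewrite wb cocc_cletter; case: b wb; rewrite ?eqxx ?letter_eqE // => wz _.
      by exists 0%N; apply: Or33.
    have [|b [c wb]] := @nleaves2 w; first by rewrite /nleaves; lia.
    exists 0%N; apply: Or32; rewrite /= cmulC; congr cmul.
    move: xw yw zw; rewrite wb !cocc_cmul !cocc_cletter n1.
    by case: b {wb}; case: c; rewrite ?eqxx ?letter_eqE // cmulC.
  - case=> xw yw zw low _; have w0 : dmon K Lz w = 0 by apply: dmon0.
    have n1 : (n <= 1)%N.
      rewrite leqNgt; apply/negP => /low[_]; rewrite dmon_cmul dmon_cletter w0 eqxx.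
      by rewrite addr0 mulr1 coefX eqxx => /eqP; rewrite oner_eq0.
    have [n0|{}n1] : n = 0%N \/ n = 1%N by lia.
      have [|b wb] := @nleaves1 w; first by rewrite /nleaves; lia.
      move: yw; rewrite wb cocc_cletter; case: b wb; rewrite ?eqxx ?letter_eqE // => wz _.
      by exists 0%N; apply: Or33; rewrite cmulC.
    have [|b [c wb]] := @nleaves2 w; first by rewrite /nleaves; lia.
    exists 0%N; apply: Or31; rewrite /= cmulC; congr cmul.
    move: xw yw zw; rewrite wb !cocc_cmul !cocc_cletter n1.
    by case: b {wb}; case: c; rewrite ?eqxx ?letter_eqE // cmulC.
move=> tw low top; have u0 := nleaves_gt0 u; have v0 := nleaves_gt0 v.
have [u1|[v1|uv1]] : nleaves u = 1%N \/ nleaves v = 1%N \/ (1 < nleaves u)%N && (1 < nleaves v)%N.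
- by lia.
- by have [a ua] := nleaves1 u1; move: tw low top; rewrite ua; apply: step; right.
- by have [a va] := nleaves1 v1; move: tw low top; rewrite va cmulC; apply: step; left.
(* With n + 2 leaves and no leaf as a factor, depth n + 1 is out of reach. *)
case/andP: uv1 => u1 v1; case: top => b /eqP[].
rewrite nth_default // -ltnS (leq_trans (size_dmon_cmul b u1 v1)) //.
by case: tw; rewrite /nleaves => -> -> ->; rewrite !addn1.
Qed.

(** * Linear forms vanishing on calF *)

Lemma dmon_cxiter b r w :
  dmon K b (cxiter r w) = 'X^r * dmon K b w + (b == Lx)%:R * ('X * geo K r).
Proof. by rewrite -partialU -xitU partial_xit sumcoefU partialU polyC1 mulr1. Qed.

Lemma cocc_cxiter b r w : cocc b (cxiter r w) = ((b == Lx) * r + cocc b w)%N.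
Proof.
elim: r => [|r IHr] /=; first by rewrite muln0.
by rewrite cocc_cmul cocc_cletter IHr mulnS addnA.
Qed.

Lemma geo_coef n k : (n <= k)%N -> (geo K n)`_k = 0.
Proof.
move=> nk; rewrite /geo coef_sum big1 // => i _.
by rewrite coefXn gtn_eqF // (leq_trans _ nk).
Qed.

Lemma partial_coef b f k : (partial b f)`_k = \sum_(w <- msupp f) f@_w * (dmon K b w)`_k.
Proof. by rewrite coef_sum; apply: eq_bigr => w _; rewrite coefZ. Qed.

(** For a letter [b] occurring once, this is 0 exactly when its depth is n or n + 1, as for y and z
    in the elements of calF of type [n,1,1]. *)
Definition theta1 n b w : K := (dmon K b w)`_n + (dmon K b w)`_n.+1 - 1.

(** Compares the leaves x at depth n + 1 with the leaves y, z at depth n. In type [n,1,1] there is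
    one of each in x^{n-1}((xy)z) and x^{n-1}((xz)y), and none in x^{n}(yz). *)
Definition theta2 n w : K :=
  (dmon K Lx w)`_n.+1 - (dmon K Ly w)`_n - (dmon K Lz w)`_n.

Lemma sum_theta1 n b f : null f -> \sum_(w <- msupp f) f@_w * theta1 n b w = 0.
Proof.
case=> sf df; transitivity ((partial b f)`_n + (partial b f)`_n.+1 - sumcoef f).
  rewrite !partial_coef /sumcoef -big_split -sumrB /=.
  by apply: eq_bigr => w _; rewrite /theta1; ring.
by rewrite sf df !coef0; ring.
Qed.

Lemma sum_theta2 n f : null f -> \sum_(w <- msupp f) f@_w * theta2 n w = 0.
Proof.
case=> _ df.
transitivity ((partial Lx f)`_n.+1 - (partial Ly f)`_n - (partial Lz f)`_n).
  by rewrite !partial_coef -!sumrB; apply: eq_bigr => w _; rewrite /theta2; ring.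
by rewrite !df !coef0; ring.
Qed.

Lemma calF_theta n w : calF w -> mtype w = (n, 1, 1)%N ->
  [/\ theta1 n Ly w = 0, theta1 n Lz w = 0 & theta2 n w = 0].
Proof.
have X2 (r : nat) : ('X^r * ('X * 'X) : {poly K}) = 'X^(r.+2) by rewrite !exprS; ring.
have X1 (r : nat) : ('X^r * 'X : {poly K}) = 'X^(r.+1) by rewrite !exprS; ring.
case=> r rw [xw _ _]; rewrite /theta1 /theta2 -xw.
case: rw => ->; rewrite cocc_cxiter !cocc_cmul !cocc_cletter !dmon_cxiter !dmon_cmul;
  rewrite !dmon_cletter !eqxx !letter_eqE /= !(addn0, mul1n, addn1, add0r, addr0, mulr1,
    mul0r, mulr0, mul1r) ?X2 ?X1 ?coefD ?(mulrC 'X) ?coefMX /= ?coefXn ?eqxx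
    ?geo_coef // ?(ltn_eqF (ltnSn _)) ?(gtn_eqF (ltnSn _)) /=;
  split; ring.
Qed.

(** If [w] is not in the support of [f], the other monomials of [g] are elements of calF of the same
    type. The three forms vanish on them and sum to 0 over [g], so they vanish at [w] too. *)
Lemma null_homogeneous_calF n w f : 2%N \notin [pchar K] ->
  in_spanF f -> mtype w = (n, 1, 1)%N -> null (<< w >> - f) ->
  homogeneous (<< w >> - f) -> calF w.
Proof.
move=> charK Ff tw nf hom; set g := << w >> - f in nf hom.
have [wf|wf] := boolP (w \in msupp f); first exact: Ff.
have gw : g@_w = 1 by rewrite mcoeffB mcoeffUU mcoeff_outdom // subr0.
have wg : w \in msupp g by rewrite -mcoeff_neq0 gw oner_eq0.
have theta0 u : u \in msupp g -> u != w ->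
    [/\ theta1 n Ly u = 0, theta1 n Lz u = 0 & theta2 n u = 0].
  move=> ug uw; apply: calF_theta; last by rewrite -tw; apply: hom.
  apply: Ff; rewrite -mcoeff_neq0; move: ug; rewrite -mcoeff_neq0 mcoeffB mcoeffU.
  by rewrite (eq_sym w) (negPf uw) sub0r oppr_eq0.
have pick (t : cmon -> K) : \sum_(u <- msupp g) g@_u * t u = 0 ->
    (forall u, u \in msupp g -> u != w -> t u = 0) -> t w = 0.
  move=> s0 t0; rewrite -s0 (big_fsetD1 w wg) /= gw mul1r big1_fset ?addr0 // => u.
  by rewrite in_fsetD1 => /andP[uw ug] _; rewrite t0 ?mulr0.
have ty : theta1 n Ly w = 0 by apply: pick (sum_theta1 _ _ nf) _ => u ug /(theta0 u ug)[].
have tz : theta1 n Lz w = 0 by apply: pick (sum_theta1 _ _ nf) _ => u ug /(theta0 u ug)[].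
have tx : theta2 n w = 0 by apply: pick (sum_theta2 _ nf) _ => u ug /(theta0 u ug)[].
have [i yi] : exists i, dmon K Ly w = 'X^i by apply: dmon1; case: tw.
have [j zj] : exists j, dmon K Lz w = 'X^j by apply: dmon1; case: tw.
(* For any other k the left side is -1. *)
have deep k : ('X^k)`_n + ('X^k)`_n.+1 - 1 = 0 :> K -> (k == n) || (k == n.+1).
  rewrite !coefXn !(eq_sym _ k); case: eqP => // _; case: eqP => // _ /eqP.
  by rewrite add0r sub0r oppr_eq0 oner_eq0.
have {ty}/orP iE : (i == n) || (i == n.+1) by apply: deep; rewrite -yi.
have {tz}/orP jE : (j == n) || (j == n.+1) by apply: deep; rewrite -zj.
apply: (deep_calF tw) => [k kn|].
  rewrite yi zj !coefXn; split.
    by case: iE => /eqP->; rewrite ltn_eqF // (ltn_trans kn).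
  by case: jE => /eqP->; rewrite ltn_eqF // (ltn_trans kn).
case: iE => /eqP iE; last by exists Ly; rewrite yi iE coefXn eqxx oner_eq0.
case: jE => /eqP jE; last by exists Lz; rewrite zj jE coefXn eqxx oner_eq0.
(* When y and z both have depth n, [theta2] makes the count of leaves x at depth n + 1 equal to 2 in
   K, which is nonzero by [charK]. *)
exists Lx; move: tx; rewrite /theta2 yi zj iE jE coefXn eqxx => /eqP.
rewrite subr_eq0 subr_eq => /eqP->.
by apply: contraNneq charK => two0; rewrite inE /= -two0.
Qed.

(** * Train polynomials through the degree in x *)

Definition xpart k f : {malg K[cmon]} :=
  [malg w in msupp f => if cocc Lx w == k then f@_w else 0].

Lemma xpartE k f w : (xpart k f)@_w = if cocc Lx w == k then f@_w else 0.
Proof.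
rewrite /xpart mcoeffE; case: ifP => // /negbT/mcoeff_outdom->.
by rewrite if_same.
Qed.

Lemma xpart_type k f : (forall w, w \in msupp f -> exists n, mtype w = (n, 1, 1)%N) ->
  xpart k f != 0 -> has_type (xpart k f) (k, 1, 1)%N.
Proof.
move=> tf nz; split=> // w; rewrite -mcoeff_neq0 xpartE.
have [xw|_] := eqVneq (cocc Lx w) k; last by rewrite eqxx.
rewrite mcoeff_neq0 => /tf[n tw].
by move: xw; case: (tw) => -> _ _ nk; rewrite tw nk.
Qed.

Lemma xpart_neq0 f w : w \in msupp f -> xpart (cocc Lx w) f != 0.
Proof.
rewrite -mcoeff_neq0; apply: contraNneq => p0.
by have := xpartE (cocc Lx w) f w; rewrite p0 mcoeff0 eqxx => <-.
Qed.

(** The part of top degree in x serves as g, and the nonzero lower parts, with sign changed, as the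
    h_i. *)
Lemma null_train f : null f -> ~ homogeneous f ->
  (forall w, w \in msupp f -> exists n, mtype w = (n, 1, 1)%N) ->
  evanescent_train_identity f.
Proof.
move=> [sf df] nhf tf; have f0 : f != 0.
  by apply: contra_notN nhf => /eqP-> u v; rewrite msupp0.
split; first by split.
pose n := degl Lx f; exists n; split=> //.
(* Degrees without monomials are skipped, since [has_type] excludes 0. *)
pose ds := [seq k <- iota 0 n | xpart k f != 0].
have ds_sorted : sorted ltn ds by apply: sorted_filter; [exact: ltn_trans | exact: iota_ltn_sorted].
have ds_P k : (k \in ds) = (xpart k f != 0) && (k < n)%N.
  by rewrite mem_filter mem_iota add0n leq0n.
have le_n w : w \in msupp f -> (cocc Lx w <= n)%N.
  by move=> wf; rewrite /n /degl; apply: (@leq_bigmax_seq _ _ xpredT).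
have top : exists2 w, w \in msupp f & cocc Lx w = n.
  have [/hasP[w wf /eqP wn]|/hasPn lt_n] := boolP (has (fun w => cocc Lx w == n) (msupp f)).
    by exists w.
  have {}lt_n w : w \in msupp f -> (cocc Lx w < n)%N.
    by move=> wf; rewrite ltn_neqAle lt_n // le_n.
  suff: (n < n)%N by rewrite ltnn.
  rewrite {1}/n /degl big_seq; elim/big_ind: _ => // [|k m kn mn]; last by rewrite gtn_max kn.
  (* The default value 0 of the maximum is also below n, because [f] has a monomial. *)
  case: (msupp f =P fset0) => [s0|/eqP/fset0Pn[w /lt_n]]; last exact: leq_ltn_trans.
  by case/eqP: f0; apply/malgP => w; rewrite mcoeff_outdom ?mcoeff0 // s0.
exists (xpart n f), (size ds), (fun i => nth 0%N ds i), (fun i => - xpart (nth 0%N ds i) f).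
have ds_nth (i : 'I_(size ds)) : nth 0%N ds i \in ds by exact: mem_nth.
split.
- rewrite sumrN opprK; apply/malgP => w; rewrite mcoeffD raddf_sum /= xpartE.
  under eq_bigr do rewrite xpartE.
  have -> : \sum_(i < size ds) (if cocc Lx w == nth 0%N ds i then f@_w else 0) =
      \sum_(k <- ds) (if cocc Lx w == k then f@_w else 0).
    by rewrite (big_nth 0%N) big_mkord.
  have [wf|wf] := boolP (w \in msupp f); last first.
    by rewrite mcoeff_outdom // if_same big1 ?addr0 // => k _; rewrite if_same.
  have [wn|wn] := eqVneq (cocc Lx w) n.
    rewrite big1_seq ?addr0 // => k /=; rewrite ds_P => /andP[_ kn].
    by rewrite wn gtn_eqF.
  rewrite add0r (bigD1_seq (cocc Lx w)) /=; first last.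
  + exact: sorted_uniq ltn_trans ltnn _ ds_sorted.
  + by rewrite ds_P xpart_neq0 // ltn_neqAle wn le_n.
  by rewrite eqxx big1 ?addr0 // => k; rewrite eq_sym => /negPf->.
- by apply: xpart_type => //; case: top => w wf <-; exact: xpart_neq0.
- move=> i; have := ds_nth i; rewrite ds_P => /andP[nz _].
  have [_ tp] := xpart_type tf nz; split; first by rewrite oppr_eq0.
  by move=> w; rewrite msuppN; exact: tp.
- move=> i j ij; apply: (sorted_ltn_nth ltn_trans 0%N ds_sorted) => //; exact: ltn_ord.
- by move=> i; have := ds_nth i; rewrite ds_P => /andP[].
Qed.

Lemma calF_type w : calF w -> exists n, mtype w = (n, 1, 1)%N.
Proof.
by case=> r [] ->; rewrite /mtype !cocc_cxiter !cocc_cmul !cocc_cletter !eqxx !letter_eqE;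
  eexists.
Qed.

End Train.

(** * Normal forms modulo calH *)

Section Ideal.
Variable K : fieldType.
Implicit Types f g h : {malg K[cmon]}.

Lemma calHD f g : calH f -> calH g -> calH (f + g).
Proof. exact: ideal_genD. Qed.

Lemma calH0 : @calH K 0.
Proof. exact: ideal_gen0. Qed.

Lemma calHMl g f : calH f -> calH (pmul g f).
Proof. exact: ideal_genMl. Qed.

Lemma pmulBr f g h : pmul f (g - h) = pmul f g - pmul f h.
Proof. exact: linearB. Qed.

Lemma calHN f : calH f -> calH (- f).
Proof. by rewrite -scaleN1r; exact: ideal_genZ. Qed.

Definition icomb (s : seq (int * cmon)) : {malg K[cmon]} :=
  \sum_(c <- s) c.1%:~R *: << c.2 >>.

Lemma icomb_nil : icomb [::] = 0. Proof. exact: big_nil. Qed.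

Lemma icomb_cons c s : icomb (c :: s) = c.1%:~R *: << c.2 >> + icomb s.
Proof. exact: big_cons. Qed.

Lemma icomb_cat s t : icomb (s ++ t) = icomb s + icomb t.
Proof. exact: big_cat. Qed.

Lemma pmul_icomb f s : pmul f (icomb s) = \sum_(c <- s) c.1%:~R *: pmul f << c.2 >>.
Proof. by rewrite [LHS]linear_sum; apply: eq_bigr => c _; rewrite [LHS]linearZ. Qed.

Lemma icomb_opp s : icomb [seq (- c.1, c.2) | c <- s] = - icomb s.
Proof.
by rewrite /icomb big_map -sumrN; apply: eq_bigr => c _; rewrite mulrNz scaleNr.
Qed.

End Ideal.

(* The list s does not depend on K, so that it gives both P_w over Q and its extension to K. *)
Definition reduces (B : cmon -> Prop) (g : forall K : fieldType, {malg K[cmon]}) :=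
  exists s : seq (int * cmon),
    (forall c, c \in s -> B c.2) /\ forall K, calH (g K - icomb K s).

Definition monomial_fam (g : forall K : fieldType, {malg K[cmon]}) w :=
  forall K, g K = << w >>.

Section Reduces.
Variable B : cmon -> Prop.
Implicit Types g h : forall K : fieldType, {malg K[cmon]}.

Lemma reduces_mod g h : (forall K, calH (g K - h K)) -> reduces B h -> reduces B g.
Proof.
move=> gh [s [Bs hs]]; exists s; split=> // K.
by rewrite -[g K](subrK (h K)) -addrA; exact: calHD.
Qed.

Lemma reduces_eq g h : (forall K, g K = h K) -> reduces B h -> reduces B g.
Proof. by move=> gh; apply: reduces_mod => K; rewrite gh subrr; exact: calH0. Qed.

Lemma reduces_mon g w : monomial_fam g w -> B w -> reduces B g.
Proof.
move=> gE Bw; exists [:: (1, w)]; split=> [c|K]; first by rewrite inE => /eqP->.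
by rewrite gE icomb_cons icomb_nil scale1r addr0 subrr; exact: calH0.
Qed.

Lemma reduces0 : reduces B (fun K => 0).
Proof. by exists [::]; split=> // K; rewrite icomb_nil subrr; exact: calH0. Qed.

Lemma reducesD g h : reduces B g -> reduces B h -> reduces B (fun K => g K + h K).
Proof.
move=> [s [Bs gs]] [t [Bt ht]]; exists (s ++ t); split=> [c|K].
  by rewrite mem_cat => /orP[/Bs|/Bt].
by rewrite icomb_cat opprD addrACA; exact: calHD.
Qed.

Lemma reducesN g : reduces B g -> reduces B (fun K => - g K).
Proof.
move=> [s [Bs gs]]; exists [seq (- c.1, c.2) | c <- s]; split=> [c|K].
  by case/mapP => d ds ->; exact: Bs ds.
by rewrite icomb_opp -opprD; exact: calHN.
Qed.

Lemma reducesMn g n : reduces B g -> reduces B (fun K => g K *+ n).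
Proof.
move=> Bg; elim: n => [|n IHn]; first exact: reduces0.
by apply: reduces_eq (reducesD Bg IHn) => K; rewrite mulrS.
Qed.

Lemma reducesZ g (c : int) : reduces B g -> reduces B (fun K => c%:~R *: g K).
Proof.
move=> Bg; case: c => n.
  by apply: reduces_eq (reducesMn n Bg) => K; rewrite -pmulrn scaler_nat.
apply: reduces_eq (reducesN (reducesMn n.+1 Bg)) => K.
by rewrite NegzE mulrNz -pmulrn scaleNr scaler_nat.
Qed.

Lemma reduces_sum m n (g : nat -> forall K : fieldType, {malg K[cmon]}) :
  (forall i, (m <= i < n)%N -> reduces B (g i)) ->
  reduces B (fun K => \sum_(m <= i < n) g i K).
Proof.
move=> Bg; have : forall i, i \in index_iota m n -> reduces B (g i).
  by move=> i; rewrite mem_index_iota; exact: Bg.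
elim: (index_iota m n) => [|i s IHs] Bs.
  by apply: reduces_eq reduces0 => K; rewrite big_nil.
have Bi : reduces B (g i) by apply: Bs; rewrite mem_head.
have {}IHs : reduces B (fun K => \sum_(j <- s) g j K).
  by apply: IHs => j js; apply: Bs; rewrite inE js orbT.
by apply: reduces_eq (reducesD Bi IHs) => K; rewrite big_cons.
Qed.

(** This and the next two lemmas push x^{i} inward, so that [get_reduces] reaches the monomials of
    [S12]. *)
Lemma reduces_xitD i g h : reduces B (fun K => xit i (g K)) ->
  reduces B (fun K => xit i (h K)) -> reduces B (fun K => xit i (g K + h K)).
Proof. by move=> Bg Bh; apply: reduces_eq (reducesD Bg Bh) => K; rewrite linearD. Qed.

Lemma reduces_xitN i g : reduces B (fun K => xit i (g K)) ->
  reduces B (fun K => xit i (- g K)).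
Proof. by move=> Bg; apply: reduces_eq (reducesN Bg) => K; rewrite linearN. Qed.

Lemma reduces_xitMn i n g : reduces B (fun K => xit i (g K)) ->
  reduces B (fun K => xit i (g K *+ n)).
Proof. by move=> Bg; apply: reduces_eq (reducesMn n Bg) => K; rewrite linearMn. Qed.

(** A generator used as a rewriting rule: its leading monomial [g] becomes [- e]. The monomial [w']
    is the one synthesized from the syntax of [g], to be identified with [w]. *)
Lemma reduces_gen w g e h : (forall K, genH (h K)) -> (forall K, h K = g K + e K) ->
  forall w', monomial_fam g w' -> w' = w -> reduces B e -> reduces B (fun K => << w >>).
Proof.
move=> Hh hE w' gw <- /reducesN; apply: reduces_mod => K; rewrite opprK -gw -hE.
exact/ideal_gen_in/Hh.
Qed.

Lemma reduces_icomb s : (forall c, c \in s -> reduces B (fun K => << c.2 >>)) ->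
  reduces B (fun K => icomb K s).
Proof.
elim: s => [|c s IHs] Bs.
  by apply: reduces_eq reduces0 => K; rewrite icomb_nil.
have Bc : reduces B (fun K => << c.2 >>) by apply: Bs; rewrite mem_head.
have {}IHs : reduces B (fun K => icomb K s).
  by apply: IHs => d ds; apply: Bs; rewrite inE ds orbT.
by apply: reduces_eq (reducesD (reducesZ c.1 Bc) IHs) => K; rewrite icomb_cons.
Qed.

Lemma reduces_cmul (B1 B2 : cmon -> Prop) u v :
  reduces B1 (fun K => << u >>) -> reduces B2 (fun K => << v >>) ->
  (forall u' v', B1 u' -> B2 v' -> reduces B (fun K => << cmul u' v' >>)) ->
  reduces B (fun K => << cmul u v >>).
Proof.
move=> [s [Bs us]] [t [Bt vt]] Buv.
apply: (@reduces_mod _ (fun K => pmul (icomb K s) (icomb K t))) => [K|].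
  (* With s and t the two combinations, uv - st = (u - s)v + s(v - t). *)
  rewrite -pmulUU -[_ - _](subrKA (pmul (icomb K s) << v >>)).
  apply: calHD; last by rewrite -pmulBr; exact: calHMl.
  by rewrite ![pmul _ << v >>]pmulC -pmulBr; exact: calHMl.
pose st := [seq (c.1 * d.1, cmul c.2 d.2) | c <- s, d <- t].
apply: (@reduces_eq _ (fun K => icomb K st)) => [K|].
  rewrite /icomb big_allpairs_dep pmulC pmul_icomb; apply: eq_bigr => c _ /=.
  rewrite pmulC pmul_icomb scaler_sumr; apply: eq_bigr => d _ /=.
  by rewrite pmulUU scalerA intrM.
apply: reduces_icomb => e /allpairsP[[c d] [/= cs dt ->]] /=.
by apply: Buv; [exact: Bs | exact: Bt].
Qed.

End Reduces.

Lemma monomial_letter a : monomial_fam (fun K => << cletter a >>) (cletter a).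
Proof. by []. Qed.

Lemma monomial_xpow k : monomial_fam (fun K => xpow K k.+1) (cxiter k (cletter Lx)).
Proof. by move=> K; rewrite xpowE xitU. Qed.

Lemma monomial_xit r g w :
  monomial_fam g w -> monomial_fam (fun K => xit r (g K)) (cxiter r w).
Proof. by move=> gw K; rewrite gw xitU. Qed.

Lemma monomial_pmul g h u v : monomial_fam g u -> monomial_fam h v ->
  monomial_fam (fun K => pmul (g K) (h K)) (cmul u v).
Proof. by move=> gu hv K; rewrite gu hv pmulUU. Qed.

Ltac get_monomial :=
  lazymatch goal with
  | |- monomial_fam (fun K => pmul _ _) _ => eapply monomial_pmul; get_monomial
  | |- monomial_fam (fun K => xit _ _) _ => eapply monomial_xit; get_monomial
  | |- monomial_fam (fun K => xpow _ _) _ => eapply monomial_xpow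
  | |- monomial_fam (fun K => mkmalgU _ _) _ => eapply monomial_letter
  end.

Ltac get_reduces :=
  lazymatch goal with
  | |- reduces _ (fun K => GRing.add _ _) => eapply reducesD; get_reduces
  | |- reduces _ (fun K => GRing.opp _) => eapply reducesN; get_reduces
  | |- reduces _ (fun K => GRing.natmul _ _) => eapply reducesMn; get_reduces
  | |- reduces _ (fun K => bigop.body _ _ _) =>
      let i := fresh "i" in let lt_i := fresh "lt_i" in
      eapply reduces_sum; intros i lt_i; get_reduces
  | |- reduces _ (fun K => S12 _ _ _) => unfold S12; get_reduces
  | |- reduces _ (fun K => xit _ (S12 _ _ _)) => unfold S12; get_reduces
  | |- reduces _ (fun K => xit _ (GRing.add _ _)) => eapply reduces_xitD; get_reduces
  | |- reduces _ (fun K => xit _ (GRing.opp _)) => eapply reduces_xitN; get_reduces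
  | |- reduces _ (fun K => xit _ (GRing.natmul _ _)) => eapply reduces_xitMn; get_reduces
  | |- reduces _ _ => eapply reduces_mon; [get_monomial | ]
  end.

(** Reassociation splits [E] into its first term and the rest; what remains is that each monomial of
    the rest is a normal form. *)
Ltac reduce_with E :=
  eapply (@reduces_gen _ _ _ _ E);
  [ | intros; unfold E_n, E_n1, E_n1_pow_iter, E_n1_iter_pow, E_n11,
        E_n11_iter_iter, E_n11_pow, E_n11_pow_iter, F_n11, G_n11;
      rewrite ?addn1 -?addrA; reflexivity
  | get_monomial
  | by []
  | get_reduces ].


(** * Products of normal forms *)

Definition powers n w := exists2 k, (k < n)%N & w = cxiter k (cletter Lx).

(** Since x^1 a is x^{1} a, the first family starts at x^2 a; [n] bounds the number of letters x. *)
Definition powers1 a n w :=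
  (exists2 k, (k.+1 < n)%N & w = cmul (cxiter k.+1 (cletter Lx)) (cletter a)) \/
  (exists2 r, (r <= n)%N & w = cxiter r (cletter a)).

(** Carries the bound on the degree in x required of P_w. *)
Definition calF_le n w := calF w /\ (cocc Lx w <= n)%N.

Lemma powers_mul m n u v : powers m u -> powers n v ->
  reduces (powers (m + n)) (fun K => << cmul u v >>).
Proof.
move=> [[|j] jm ->] [[|k] kn ->].
- by apply: (@reduces_mon _ _ (cxiter 1 (cletter Lx))) => //; exists 1%N => //; lia.
- by apply: (@reduces_mon _ _ (cxiter k.+2 (cletter Lx))) => //; exists k.+2 => //; lia.
- by rewrite cmulC; apply: (@reduces_mon _ _ (cxiter j.+2 (cletter Lx))) => //;
    exists j.+2 => //; lia.
reduce_with (fun K => E_n K j.+2 k.+2); first by move=> K; exact: genH_E_n.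
- by exists j.+2 => //; lia.
- by exists k.+2 => //; lia.
- by exists 1%N => //; lia.
Qed.

Lemma powers1_mul a m n u v : a \in [:: Ly; Lz] -> powers m u -> powers1 a n v ->
  reduces (powers1 a (m + n)) (fun K => << cmul u v >>).
Proof.
move=> ayz [[|j] jm ->] [] [k kn ->].
(* The generator with r = 1 rewrites x(x^p a). *)
- reduce_with (fun K => E_n1_iter_pow K 1 k.+2 a); first by move=> K; exact: genH_E_n1_iter_pow.
  + by right; exists 2%N => //; lia.
  + by left; exists (k.+1) => //; lia.
  + by left; exists 0%N => //; lia.
- apply: (@reduces_mon _ _ (cxiter k.+1 (cletter a))) => //.
  by right; exists k.+1 => //; lia.
- reduce_with (fun K => E_n1 K j.+2 k.+2 a); first by move=> K; exact: genH_E_n1.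
  + by right; exists 2%N => //; lia.
  + by left; exists j => //; lia.
  + by left; exists k.+1 => //; lia.
  + by left; exists 0%N => //; lia.
  + by right; exists 1%N => //; lia.
- reduce_with (fun K => E_n1_pow_iter K j.+2 k a); first by move=> K; exact: genH_E_n1_pow_iter.
  + by left; exists j => //; lia.
  + by right; exists k.+1 => //; lia.
  + by right; exists 1%N => //; lia.
Qed.

(** The bound on [r] is strict because (x a1) a2 holds one more x. *)
Lemma calF_le_xa n r a1 a2 : a1 \in [:: Ly; Lz] -> a2 \in [:: Ly; Lz] -> a1 != a2 ->
  (r < n)%N -> calF_le n (cxiter r (cmul (cmul (cletter Lx) (cletter a1)) (cletter a2))).
Proof.
rewrite !inE => /orP[] /eqP-> /orP[] /eqP->; rewrite ?eqxx // => _ rn; split.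
- by exists r; apply: Or31.
- by rewrite cocc_cxiter !cocc_cmul !cocc_cletter eqxx !letter_eqE /=; lia.
- by exists r; apply: Or32.
- by rewrite cocc_cxiter !cocc_cmul !cocc_cletter eqxx !letter_eqE /=; lia.
Qed.

Lemma calF_le_a n r a1 a2 : a1 \in [:: Ly; Lz] -> a2 \in [:: Ly; Lz] -> a1 != a2 ->
  (r <= n)%N -> calF_le n (cxiter r (cmul (cletter a1) (cletter a2))).
Proof.
rewrite !inE => /orP[] /eqP-> /orP[] /eqP->; rewrite ?eqxx // => _ rn; split.
- by exists r; apply: Or33.
- by rewrite cocc_cxiter !cocc_cmul !cocc_cletter eqxx !letter_eqE /=; lia.
- by exists r; apply: Or33; rewrite [cmul (cletter Lz) _]cmulC.
- by rewrite cocc_cxiter !cocc_cmul !cocc_cletter eqxx !letter_eqE /=; lia.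
Qed.

Lemma yz_letters :
  [/\ Ly \in [:: Ly; Lz], Lz \in [:: Ly; Lz], Ly != Lz & Lz != Ly].
Proof. by rewrite !inE !eqxx !letter_eqE. Qed.

(* The last three cases are the monomials (x a1) a2, x (a1 a2) and a1 a2 written without x^{r}. *)
Ltac calF_le_tac :=
  first
  [ by apply: calF_le_xa => //; rewrite 1?eq_sym //; lia
  | by apply: calF_le_a => //; rewrite 1?eq_sym //; lia
  | by apply: (@calF_le_xa _ 0) => //; rewrite 1?eq_sym //; lia
  | by apply: (@calF_le_a _ 1) => //; rewrite 1?eq_sym //; lia
  | by apply: (@calF_le_a _ 0) => //; rewrite 1?eq_sym //; lia ].

Lemma powers_xa_mul m n j r a1 a2 : a1 \in [:: Ly; Lz] -> a2 \in [:: Ly; Lz] -> a1 != a2 ->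
  (j.+1 < m)%N -> (r < n)%N ->
  reduces (calF_le (m + n)) (fun K => << cmul (cxiter j.+1 (cletter Lx))
    (cxiter r (cmul (cmul (cletter Lx) (cletter a1)) (cletter a2))) >>).
Proof.
move=> a1yz a2yz a12 jm rn.
reduce_with (fun K => G_n11 K j.+2 r a1 a2);
    first [by move=> K; exact: genH_G_n11 | calF_le_tac].
Qed.

Lemma calF_le_powers_mul m n u v : powers m u -> calF_le n v ->
  reduces (calF_le (m + n)) (fun K => << cmul u v >>).
Proof.
have [yin zin yz zy] := yz_letters.
move=> [[|j] jm ->] [].
  move=> Fv xv; apply: (@reduces_mon _ _ (cmul (cletter Lx) v)) => //.
  by split; [exact: calF_cmul | rewrite cocc_cmul cocc_cletter eqxx; lia].
case=> r [] -> xv; rewrite cocc_cxiter !cocc_cmul !cocc_cletter ?eqxx !letter_eqE /= in xv.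
- by apply: powers_xa_mul => //; lia.
- by apply: powers_xa_mul => //; lia.
reduce_with (fun K => F_n11 K j.+2 r);
    first [by move=> K; exact: genH_F_n11 | calF_le_tac].
Qed.

Lemma powers1_pow_iter_mul m n k r a1 a2 :
  a1 \in [:: Ly; Lz] -> a2 \in [:: Ly; Lz] -> a1 != a2 -> (k.+1 < m)%N -> (r <= n)%N ->
  reduces (calF_le (m + n))
    (fun K => << cmul (cmul (cxiter k.+1 (cletter Lx)) (cletter a1))
                   (cxiter r (cletter a2)) >>).
Proof.
case: r => [|r] a1yz a2yz a12 km rn.
- reduce_with (fun K => E_n11_pow K k.+2 a1 a2);
    first [by move=> K; exact: genH_E_n11_pow | calF_le_tac].
- reduce_with (fun K => E_n11_pow_iter K k.+2 r a1 a2);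
    first [by move=> K; exact: genH_E_n11_pow_iter | calF_le_tac].
Qed.

Lemma powers1_powers1_mul m n u v : powers1 Ly m u -> powers1 Lz n v ->
  reduces (calF_le (m + n)) (fun K => << cmul u v >>).
Proof.
have [yin zin yz zy] := yz_letters.
move=> [] [k km ->] [] [r rn ->].
- reduce_with (fun K => E_n11 K k.+2 r.+2);
    first [by move=> K; exact: genH_E_n11 | calF_le_tac].
- exact: powers1_pow_iter_mul.
- by rewrite cmulC addnC; exact: powers1_pow_iter_mul.
- reduce_with (fun K => E_n11_iter_iter K k r);
    first [by move=> K; exact: genH_E_n11_iter_iter | calF_le_tac].
Qed.

(** * Reduction of arbitrary monomials *)

Lemma reduces_powers w : cocc Ly w = 0%N -> cocc Lz w = 0%N ->
  reduces (powers (cocc Lx w)) (fun K => << w >>).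
Proof.
elim/cmon_ind: w => [b|u v IHu IHv].
  rewrite !cocc_cletter; case: b; rewrite ?eqxx ?letter_eqE // => _ _.
  by apply: (@reduces_mon _ _ (cletter Lx)) => //; exists 0%N.
rewrite !cocc_cmul => /eqP; rewrite addn_eq0 => /andP[/eqP uy /eqP vy].
move=> /eqP; rewrite addn_eq0 => /andP[/eqP uz /eqP vz].
by apply: reduces_cmul (IHu uy uz) (IHv vy vz) _ => u' v'; exact: powers_mul.
Qed.

Lemma reduces_powers1 a w : a \in [:: Ly; Lz] ->
  (forall b, b \in [:: Ly; Lz] -> cocc b w = (b == a)) ->
  reduces (powers1 a (cocc Lx w)) (fun K => << w >>).
Proof.
move=> ayz; elim/cmon_ind: w => [b|u v IHu IHv] wE.
  have -> : b = a.
    case: b wE => wE; last first.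
    - by have := wE Lz; rewrite !inE eqxx orbT cocc_cletter eqxx => /(_ isT); case: eqP.
    - by have := wE Ly; rewrite !inE eqxx cocc_cletter eqxx => /(_ isT); case: eqP.
    - by have := wE a ayz; rewrite cocc_cletter eqxx; case: eqP.
  apply: (@reduces_mon _ _ (cletter a)) => //; right.
  by exists 0%N.
(* The single leaf [a] lies in one factor; the other contains only x. *)
have two : (forall b, b \in [:: Ly; Lz] -> cocc b u = (b == a) /\ cocc b v = 0%N) \/
           (forall b, b \in [:: Ly; Lz] -> cocc b u = 0%N /\ cocc b v = (b == a)).
  have := wE a ayz; rewrite cocc_cmul eqxx => ea.
  have [ua|ua] : cocc a u = 1%N \/ cocc a u = 0%N by case: (cocc a u) ea => [|[|]]; auto.
    left=> b byz; have := wE b byz; rewrite cocc_cmul.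
    by have [->|_] := eqVneq b a; rewrite ?ua; lia.
  right=> b byz; have := wE b byz; rewrite cocc_cmul.
  by have [->|_] := eqVneq b a; rewrite ?ua; lia.
have [yin zin _ _] := yz_letters.
rewrite cocc_cmul; case: two => two.
  rewrite cmulC addnC; apply: (reduces_cmul (B1 := powers (cocc Lx v)) _ (IHu _)).
  - by apply: reduces_powers; [case: (two Ly yin) | case: (two Lz zin)].
  - by move=> b /two[].
  - by move=> u' v'; exact: powers1_mul.
apply: (reduces_cmul (B1 := powers (cocc Lx u)) _ (IHv _)).
- by apply: reduces_powers; [case: (two Ly yin) | case: (two Lz zin)].
- by move=> b /two[].
- by move=> u' v'; exact: powers1_mul.
Qed.

(** If y and z lie in the same factor, the other reduces to powers of x; if they are separated, each
    factor reduces to [powers1]. *)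
Lemma reduces_calF n w : mtype w = (n, 1, 1)%N ->
  reduces (calF_le n) (fun K => << w >>).
Proof.
case=> <-; elim/cmon_ind: w => [b|u v IHu IHv].
  by rewrite !cocc_cletter; case: b; rewrite ?eqxx ?letter_eqE.
rewrite !cocc_cmul => uvy uvz; have [yin zin _ _] := yz_letters.
have Ry w : cocc Ly w = 1%N -> cocc Lz w = 0%N ->
    reduces (powers1 Ly (cocc Lx w)) (fun K => << w >>).
  move=> wy wz; apply: reduces_powers1 => //.
  by move=> b; rewrite !inE => /orP[]/eqP->; rewrite ?eqxx ?letter_eqE.
have Rz w : cocc Ly w = 0%N -> cocc Lz w = 1%N ->
    reduces (powers1 Lz (cocc Lx w)) (fun K => << w >>).
  move=> wy wz; apply: reduces_powers1 => //.
  by move=> b; rewrite !inE => /orP[]/eqP->; rewrite ?eqxx ?letter_eqE.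
have [[uy vy]|[uy vy]] : cocc Ly u = 1%N /\ cocc Ly v = 0%N \/
    cocc Ly u = 0%N /\ cocc Ly v = 1%N by lia.
  have [[uz vz]|[uz vz]] : cocc Lz u = 1%N /\ cocc Lz v = 0%N \/
      cocc Lz u = 0%N /\ cocc Lz v = 1%N by lia.
    rewrite cmulC addnC; apply: reduces_cmul (reduces_powers vy vz) (IHu uy uz) _.
    by move=> u' v'; exact: calF_le_powers_mul.
  by apply: reduces_cmul (Ry u uy uz) (Rz v vy vz) _ => u' v'; exact: powers1_powers1_mul.
have [[uz vz]|[uz vz]] : cocc Lz u = 1%N /\ cocc Lz v = 0%N \/
    cocc Lz u = 0%N /\ cocc Lz v = 1%N by lia.
  rewrite cmulC addnC; apply: reduces_cmul (Ry v vy vz) (Rz u uy uz) _ => u' v'.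
  exact: powers1_powers1_mul.
apply: reduces_cmul (reduces_powers uy uz) (IHv vy vz) _ => u' v'.
exact: calF_le_powers_mul.
Qed.

(** * Existence and uniqueness of P_w and of reductions *)

Lemma icomb_coef (K : fieldType) s v :
  (icomb K s)@_v = (\sum_(c <- s) c.1 *+ (c.2 == v))%:~R.
Proof.
rewrite /icomb raddf_sum rmorph_sum; apply: eq_bigr => c _ /=.
by rewrite mcoeffZ mcoeffU rmorphMn /= mulrnAr mulr1.
Qed.

Section Main.
Variable K : fieldType.
Implicit Types f g P : {malg K[cmon]}.

Lemma msupp_icomb s w : w \in msupp (icomb K s) -> exists2 c, c \in s & c.2 = w.
Proof.
rewrite -mcoeff_neq0 icomb_coef => nz.
have /hasP[c cs /eqP cw] : has (fun c => c.2 == w) s; last by exists c.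
apply: contraNT nz => /hasPn ns; rewrite big1_seq // => c /= /ns/negPf->.
by rewrite mulr0n.
Qed.

(** Corresponding coefficients over Q and K are images of the same integer, and [ratr] carries one
    image to the other. *)
Lemma scalar_ext_icomb s : scalar_ext K (icomb rat s) = icomb K s.
Proof.
apply/malgP => v; rewrite icomb_coef /scalar_ext raddf_sum /=.
under eq_bigr do rewrite mcoeffU.
transitivity (ratr (icomb rat s)@_v : K); last by rewrite icomb_coef ratr_int.
have [vs|vs] := boolP (v \in msupp (icomb rat s)).
  rewrite (big_fsetD1 v vs) /= eqxx big1_fset ?addr0 // => w.
  by rewrite in_fsetD1 => /andP[/negPf-> _] _; rewrite mulr0n.
rewrite (mcoeff_outdom vs) (ratr_int K 0) big1_fset // => w ws _.
by case: eqP vs ws => [-> /negPf->|].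
Qed.

Lemma in_spanFB f g : in_spanF f -> in_spanF g -> in_spanF (f - g).
Proof.
move=> Ff Fg w wfg; have : w \in (msupp f `|` msupp g)%fset.
  exact: (fsubsetP (msuppB_le f g)).
by rewrite in_fsetU => /orP[/Ff|/Fg].
Qed.

Lemma in_spanF_inj f g : in_spanF f -> in_spanF g ->
  (forall b, partial b f = partial b g) -> f = g.
Proof.
move=> Ff Fg fg; apply/eqP; rewrite -subr_eq0; apply/eqP.
apply: in_spanF_partial0; first exact: in_spanFB.
by move=> b; rewrite linearB /= fg subrr.
Qed.

Lemma is_P_inj n w P P' : is_P n w P -> is_P n w P' -> P = P'.
Proof.
move=> [FP _ [[_ dP _] _]] [FP' _ [[_ dP' _] _]]; apply: in_spanF_inj => // b.
by apply: oppr_inj; apply: (addrI (partial b << w >>)); rewrite -!linearB /= dP dP'.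
Qed.

Lemma in_spanF_icomb n s : (forall c, c \in s -> calF_le n c.2) ->
  in_spanF (icomb K s) /\ (degl Lx (icomb K s) <= n)%N.
Proof.
move=> Fs; split=> [w /msupp_icomb[c /Fs[Fc _] <-] //|].
rewrite /degl; apply/bigmax_leqP_seq => w /msupp_icomb[c /Fs[_ xc] <-] _.
exact: xc.
Qed.

(** Membership in calH gives the evanescence; non-homogeneity comes from [null_homogeneous_calF], as
    [w] lies outside calF. *)
Lemma is_P_icomb n w s : 2%N \notin [pchar K] -> mtype w = (n, 1, 1)%N -> ~ calF w ->
  (forall c, c \in s -> calF_le n c.2) -> calH (<< w >> - icomb K s) ->
  is_P n w (icomb K s).
Proof.
move=> charK tw nFw Fs /null_calH nws.
have [Fi di] := in_spanF_icomb Fs; split=> //; apply: null_train => //.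
  by move=> /(null_homogeneous_calF charK Fi tw nws).
move=> u uws; have : u \in (msupp (<< w >> : {malg K[cmon]}) `|` msupp (icomb K s))%fset.
  exact: (fsubsetP (msuppB_le _ _)).
rewrite in_fsetU msuppU oner_eq0 in_fset1 => /orP[/eqP->|/Fi/calF_type //].
by exists n.
Qed.

Lemma reduction_exists f : in_sum_n11 f ->
  exists R, is_reduction f R.
Proof.
move=> tf; rewrite [f]monalgE big_seq; elim/big_ind: _ => [|g h|w /tf[n _ tw]].
- by exists 0; split=> [w|]; [rewrite msupp0 | rewrite /eq_mod_calH subrr; exact: calH0].
- move=> [R [FR gR]] [S [FS hS]]; exists (R + S); split.
    by rewrite -[S]opprK; apply: in_spanFB => // w; rewrite msuppN => /FS.
  by rewrite /eq_mod_calH opprD addrACA; exact: calHD.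
have [s [Fs ws]] := reduces_calF tw.
exists (f@_w *: icomb K s); split=> [u us|].
  have [Fi _] := in_spanF_icomb Fs; apply: Fi.
  exact: (fsubsetP (msuppZ_le _ _)) us.
by rewrite /eq_mod_calH malgUZ -scalerBr; apply: ideal_genZ; exact: ws.
Qed.

Lemma is_reduction_inj f R R' : is_reduction f R -> is_reduction f R' -> R = R'.
Proof.
move=> [FR /null_calH[_ dR]] [FR' /null_calH[_ dR']]; apply: in_spanF_inj => // b.
by apply: oppr_inj; apply: (addrI (partial b f)); rewrite -!linearB /= dR dR'.
Qed.

End Main.

Theorem mainTheorem7 (K : fieldType) (charK : 2%N \notin [pchar K]) :
  (forall (n : nat) (w : cmon),
      (2 <= n)%N -> mtype w = (n, 1, 1)%N -> ~ calF w ->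
      enough_scalars (<< w >> : {malg K[cmon]}) ->
      exists P : {malg rat[cmon]},
        [/\ unique (is_P n w) P,
            defined_over K P,
            unique (is_P n w) (scalar_ext K P)
          & eq_mod_calH << w >> (scalar_ext K P)])
  /\
  (forall f : {malg K[cmon]},
      in_sum_n11 f -> enough_scalars f ->
      exists R : {malg K[cmon]},
        [/\ unique (is_reduction f) R,
            f - R != 0 -> evanescent_identity (f - R)
          & ~ homogeneous (f - R) -> evanescent_train_identity (f - R)]).
Proof.
split=> [n w n2 tw nFw _ | f tf _].
  (* One integral list [s] gives P_w over Q and its image over K. *)
  have [s [Fs ws]] := reduces_calF tw.
  have char_rat : 2%N \notin [pchar rat] by rewrite Num.Theory.pchar_num.
  exists (icomb rat s); rewrite scalar_ext_icomb; split.
  - split; first exact: is_P_icomb.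
    by move=> P; apply: is_P_inj; exact: is_P_icomb.
  - by move=> v; rewrite icomb_coef denq_int oner_eq0.
  - split; first exact: is_P_icomb.
    by move=> P; apply: is_P_inj; exact: is_P_icomb.
  - exact: ws.
have [R redR] := reduction_exists tf; have [FR /null_calH nfR] := redR.
exists R; split; first by split=> // R'; exact: is_reduction_inj.
  by case: nfR.
(* What remains is that every monomial of [f - R] has a type [k,1,1]. *)
move=> nhom; apply: null_train => // w wfR.
have : w \in (msupp f `|` msupp R)%fset by exact: (fsubsetP (msuppB_le f R)).
by rewrite in_fsetU => /orP[/tf[n _ tw]|/FR/calF_type //]; exists n.
Qed.
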